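(* Let $\mathsf{N}_n$ be a uniformly random simplex tree-child network with $n$ taxa. On the event that $\mathsf{N}_n$ has at least one tree vertex, let $u_n$ be chosen uniformly at random among the tree vertices of $\mathsf{N}_n$ (on the complementary event $u_n$ is an arbitrary vertex). There exists a deterministic infinite rooted network $(\hat{\mathcal{L}},p_0)$, namely the one constructed in the context, such that $(\mathsf{N}_n,u_n)\xrightarrow{d}(\hat{\mathcal{L}},p_0)$ in the local weak sense as $n\to\infty$.
   Context: A simplex tree-child network on a finite set $X$ is a finite directed acyclic graph $N=(V,E)$ with a root $o$ and with leaves bijectively labelled by $X$, such that: the root has (indegree, outdegree) $=(0,1)$; every vertex is reachable from $o$ by a directed path; every leaf has degree $(1,0)$; every vertex that is neither the root nor a leaf is either a tree vertex, of degree $(1,2)$, or a reticulation vertex, of degree $(2,1)$; (tree-child) every non-leaf vertex has at least one child that is a tree vertex or a leaf; (one-component) the unique child of every reticulation vertex is a leaf. Networks are considered up to isomorphism preserving leaf labels. $\mathsf{N}_n$ is uniform on the finite set of simplex tree-child networks with leaf label set $[n]$. Local neighbourhoods: for a directed graph $N$ and $v\in V(N)$, $U_R(N,v)$ is the subgraph induced by the vertices at undirected graph distance at most $R$ from $v$, rooted at $v$. Each vertex carries a mark giving its type in $N$ (root, tree vertex, reticulation, or leaf); leaf labels are ignored. $\cong$ denotes isomorphism of rooted directed marked graphs, i.e. a bijection of vertex sets preserving root, marks, edges and edge orientations. Local weak convergence $(N_n,v_n)\xrightarrow{d}(N,v)$ means $\mathbb{P}(U_R(N_n,v_n)\cong G)\to\mathbb{P}(U_R(N,v)\cong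 G)$ for every fixed $R\ge0$ and every finite rooted directed marked graph $G$; for deterministic $(N,v)$ this is $\mathbb{P}(U_R(N_n,v_n)\cong U_R(N,v))\to1$ for every $R\ge0$. Construction. A bi-infinite spine is a bi-infinite directed path $\cdots\to x_{-1}\to x_0\to x_1\to\cdots$ of tree vertices. To decorate a tree vertex $x$ means: give $x$ a new reticulation child $\rho(x)$; give $\rho(x)$ a new leaf child $\ell(x)$; and give $\rho(x)$ a second parent $w(x)$, which is a tree vertex on a new bi-infinite spine, all of whose vertices other than $w(x)$ are in turn decorated, recursively (the reticulation child of $w(x)$ is $\rho(x)$). All spines and vertices introduced at every level are pairwise distinct. The decorated chain $\hat{\mathcal{L}}$ is a bi-infinite spine $\cdots\to p_{-1}\to p_0\to p_1\to\cdots$ all of whose vertices are decorated; it is rooted at $p_0$. *)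

(* Defs.v *)
From HB Require Import structures.
From mathcomp Require Import all_boot all_order all_algebra.
From mathcomp Require Import zify.
From mathcomp Require Import all_classical all_reals all_analysis.
Set Implicit Arguments.
Unset Strict Implicit.
Unset Printing Implicit Defensive.
Import Order.TTheory GRing.Theory Num.Theory.
Import numFieldNormedType.Exports.
Local Open Scope classical_set_scope.
Local Open Scope ring_scope.

Section Digraph.
Variables (V : finType) (E : rel V).

Definition degree (v : V) : nat * nat := (#|[pred u | E u v]|, #|[pred u | E v u]|).

Definition is_root v := degree v == (0, 1)%N.
Definition is_leaf v := degree v == (1, 0)%N.
Definition is_tree v := degree v == (1, 2)%N.
Definition is_retic v := degree v == (2, 1)%N.

(* There are no parallel arcs: a vertex joined to another one by two arcs would
   be a tree vertex whose only child is a reticulation, which [stc_tree_child]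
   excludes, so a relation [E] loses nothing. *)
Record simplex_tree_child (n : nat) (lab : 'I_n -> V) : Prop := SimplexTreeChild {
  stc_acyclic : forall u v, E u v -> ~~ connect E v u;
  stc_rooted : exists o, [/\ is_root o, forall v, connect E o v &
    forall v, v != o -> v \notin codom lab -> is_tree v || is_retic v];
  stc_lab_inj : injective lab;
  stc_lab_leaf : forall i, is_leaf (lab i);
  stc_tree_child : forall v, ~~ is_leaf v ->
    exists2 u, E v u & is_tree u || is_leaf u;
  stc_one_component : forall v u, is_retic v -> E v u -> is_leaf u }.

End Digraph.

Definition net_iso n (V V' : finType) (E : rel V) (E' : rel V')
    (lab : 'I_n -> V) (lab' : 'I_n -> V') : Prop :=
  exists f : V -> V', [/\ bijective f, forall u v, E' (f u) (f v) = E u v &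
    forall i, f (lab i) = lab' i].

(* A concrete finite type containing a copy of every network on ['I_n] (see
   [network_complete]): such a network has at most [4 * n] vertices, so its vertex
   set may be taken to be ['I_m] with [m <= 4 * n]. *)
Definition net_data (n : nat) : finType :=
  {m : 'I_(4 * n).+1 & ({set 'I_m * 'I_m} * {ffun 'I_n -> 'I_m})%type}.

Section NetData.
Variable n : nat.
Definition net_vertex (N : net_data n) : finType := 'I_(tag N).
Definition net_edge (N : net_data n) : rel (net_vertex N) :=
  fun u v => (u, v) \in (tagged N).1.
Definition net_label (N : net_data n) : 'I_n -> net_vertex N := (tagged N).2.
End NetData.

Definition network (n : nat) : finType :=
  {N : net_data n | `[< simplex_tree_child (net_edge (N := N)) (net_label N) >]}.

Section Network.
Variables (n : nat) (N : network n).
Definition vertex : finType := net_vertex (val N).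
Definition arc : rel vertex := net_edge (N := val N).
Definition label : 'I_n -> vertex := net_label (val N).
End Network.
Arguments arc {n} N.
Arguments label {n} N.

Definition network_iso n : rel (network n) :=
  fun N N' => `[< net_iso (arc N) (arc N') (label N) (label N') >].

Definition network_reps n : {set network n} :=
  transversal (equivalence_partition (@network_iso n) [set: network n]%SET)
    [set: network n]%SET.

Section Complete.
Variables (n : nat) (V : finType) (E : rel V) (lab : 'I_n -> V).
Hypothesis H : simplex_tree_child E lab.

Let is_leafE v : is_leaf E v = (v \in codom lab).
Proof.
apply/idP/idP => [/eqP dv|/codomP[i ->]]; last exact: stc_lab_leaf H i.
have [z [/eqP ro _ ho]] := stc_rooted H.
apply: contraT => vl; have vo : v != z by apply/eqP => vo; rewrite vo ro in dv.
by have := ho v vo vl; rewrite /is_tree /is_retic dv.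
Qed.

Lemma card_simplex_tree_child : (#|V| <= 4 * n)%N.
Proof.
have [z [/eqP ro _ ho]] := stc_rooted H.
pose l v : nat := is_leaf E v; pose t v : nat := is_tree E v.
pose r v : nat := is_retic E v; pose s v : nat := v == z.
have all4 v : [/\ (s v + t v + r v + l v)%N = 1%N,
    (degree E v).1 = (l v + t v + r v * 2)%N &
    (degree E v).2 = (s v + t v * 2 + r v)%N].
  rewrite /l /t /r /s; case: eqVneq => [->|vo].
    by rewrite /is_leaf /is_tree /is_retic ro.
  have [lv|nlv] := boolP (is_leaf E v).
    by move: lv; rewrite /is_leaf /is_tree /is_retic => /eqP ->.
  have := ho v vo; rewrite -is_leafE nlv => /(_ isT).
  by rewrite /is_tree /is_retic => /orP[] /eqP ->.
have sumE : \sum_v (degree E v).1 = \sum_v (degree E v).2.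
  under eq_bigr do rewrite /degree /= -sum1_card big_mkcond /=.
  under [RHS]eq_bigr do rewrite /degree /= -sum1_card big_mkcond /=.
  by rewrite exchange_big.
have sS : (\sum_v s v = 1)%N.
  by rewrite /s -big_mkcond /= sum1_card card1.
have sL : (\sum_v l v = n)%N.
  rewrite /l -big_mkcond /= sum1_card (eq_card is_leafE).
  by rewrite card_codom ?card_ord //; exact: stc_lab_inj H.
have sR : (\sum_v r v <= \sum_v l v)%N.
  apply: (@leq_trans (\sum_v \sum_u (is_leaf E u && E v u : nat))).
    apply: leq_sum => v _; rewrite /r.
    have [rv|//] := boolP (is_retic E v).
    have /card_gt0P[u /= vu] : (0 < #|[pred u | E v u]|)%N.
      by move: rv; rewrite /is_retic /degree => /eqP[_ ->].
    rewrite inE in vu.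
    by rewrite (bigD1 u) //= vu (stc_one_component H rv vu).
  rewrite exchange_big /=; apply: leq_sum => u _; rewrite /l.
  have [lu|_] := boolP (is_leaf E u); last by rewrite big1.
  rewrite -big_mkcond /= sum1_card.
  by move: lu; rewrite /is_leaf /degree => /eqP[-> _].
have c4 : (#|V| = \sum_v s v + \sum_v t v + \sum_v r v + \sum_v l v)%N.
  rewrite -sum1_card -!big_split; apply: eq_bigr => v _.
  by case: (all4 v) => /= ->.
have e1 : (\sum_v l v + \sum_v t v + (\sum_v r v) * 2 =
           \sum_v s v + (\sum_v t v) * 2 + \sum_v r v)%N.
  rewrite !big_distrl -!big_split /=.
  transitivity (\sum_v (degree E v).1)%N.
    by apply: eq_bigr => v _; case: (all4 v) => _ ->.
  by rewrite sumE; apply: eq_bigr => v _; case: (all4 v) => _ _ ->.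
move: sR e1; rewrite c4 sS sL.
by move: (bigop _ _ _) (bigop _ _ _) => T Q; clear; lia.
Qed.
End Complete.

Lemma network_complete n (V : finType) (E : rel V) (lab : 'I_n -> V) :
  simplex_tree_child E lab ->
  exists N : network n, net_iso E (arc N) lab (label N).
Proof.
move=> H; have cV : (#|V| < (4 * n).+1)%N by exact: card_simplex_tree_child H.
pose m : 'I_(4 * n).+1 := Ordinal cV.
pose A : {set 'I_m * 'I_m} := [set p | E (enum_val p.1) (enum_val p.2)]%SET.
pose L : {ffun 'I_n -> 'I_m} := [ffun i => enum_rank (lab i)].
pose D : net_data n :=
  Tagged (fun m : 'I_(4 * n).+1 => ({set 'I_m * 'I_m} * {ffun 'I_n -> 'I_m})%type)
    (A, L).
pose f (v : V) : net_vertex D := enum_rank v.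
pose g (v : net_vertex D) : V := enum_val v.
have fK : cancel f g by move=> v; exact: enum_rankK.
have gK : cancel g f by move=> v; exact: enum_valK.
have fb : bijective f by exists g.
have gb : bijective g by exists f.
have arcE u v : net_edge (f u) (f v) = E u v.
  by rewrite /net_edge /= inE /= !enum_rankK.
have arcE' u v : net_edge u v = E (g u) (g v) by rewrite -arcE !gK.
have labE i : f (lab i) = net_label D i by rewrite /net_label /= ffunE.
have degE v : degree (@net_edge n D) v = degree E (g v).
  rewrite /degree; congr pair.
    rewrite -(fintype.card_image (can_inj fK)); apply: eq_card => u; apply/idP/fintype.imageP.
      by rewrite inE /= arcE' => h; exists (g u); rewrite ?gK.
    by case=> w; rewrite !inE /= => h ->; rewrite arcE' fK.
  rewrite -(fintype.card_image (can_inj fK)); apply: eq_card => u; apply/idP/fintype.imageP.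
    by rewrite inE /= arcE' => h; exists (g u); rewrite ?gK.
  by case=> w; rewrite !inE /= => h ->; rewrite arcE' fK.
have conE u v : connect (@net_edge n D) u v = connect E (g u) (g v).
  apply/connectP/connectP => -[p].
    move=> pp ->; exists (map g p); last by rewrite last_map.
    by rewrite path_map; apply: sub_path pp => x y; rewrite /relpre /= arcE'.
  move=> pp e; exists (map f p).
    rewrite -(gK u) path_map; apply: sub_path pp => x y.
    by rewrite /relpre /= arcE.
  by rewrite -(gK u) last_map -e gK.
suff HD : simplex_tree_child (@net_edge n D) (net_label D).
  have PD : `[< simplex_tree_child (@net_edge n D) (net_label D) >].
    exact/asboolP.
  by exists (exist _ D PD), f.
have [z [rz cz hz]] := stc_rooted H.
split.
- by move=> u v; rewrite arcE' conE; exact: stc_acyclic H _ _.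
- exists (f z); rewrite /is_root degE fK; split => //.
    by move=> v; rewrite conE fK.
  move=> v vz vl; rewrite /is_tree /is_retic degE; apply: hz.
    by apply: contra vz => /eqP <-; rewrite gK.
  by apply: contra vl => /codomP[i e]; rewrite -(gK v) e labE codom_f.
- by move=> i j; rewrite -!labE => /(can_inj fK); exact: stc_lab_inj H _ _.
- by move=> i; rewrite -labE /is_leaf degE fK; exact: stc_lab_leaf H _.
- move=> v; rewrite /is_leaf degE => /(stc_tree_child H)[u vu hu].
  exists (f u); first by rewrite arcE' fK.
  by rewrite /is_tree /is_leaf degE fK.
- move=> v u; rewrite /is_retic degE arcE' => rv /(stc_one_component H rv).
  by rewrite /is_leaf degE.
Qed.

Inductive vtype := Root | Tree | Retic | Leaf.

Record rgraph := RGraph {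
  gvert : Type;
  garc : gvert -> gvert -> Prop;
  gmark : gvert -> vtype;
  groot : gvert }.

Definition rgraph_iso (G H : rgraph) : Prop :=
  exists f : gvert G -> gvert H, [/\ bijective f, f (groot G) = groot H,
    forall v, gmark (f v) = gmark v & forall u v, garc (f u) (f v) <-> garc u v].

Fixpoint gball (r : nat) (G : rgraph) : set (gvert G) :=
  if r is r'.+1 then
    [set v | gball r' v \/ exists2 u, gball r' u & garc u v \/ garc v u]
  else [set groot G].

Lemma groot_ball r G : @gball r G (groot G).
Proof. by elim: r => [|r IH] //=; left. Qed.

(* [U_r(N, v)], where [v] is the root of [G]. *)
Definition neighbourhood (r : nat) (G : rgraph) : rgraph :=
  @RGraph (set_type (@gball r G)) (fun u v => garc (val u) (val v))
    (fun v => gmark (val v)) (SigSub (mem_set (groot_ball r G))).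

(* A law of a random rooted graph is given by the probability of each event. *)
Definition rgraph_law (R : realType) := (rgraph -> Prop) -> R.

Definition local_weak_cvg (R : realType) (mu : nat -> rgraph_law R)
    (nu : rgraph_law R) : Prop :=
  forall (r : nat) (G : rgraph), finite_set [set: gvert G] ->
    mu n (fun N => rgraph_iso (neighbourhood r N) G) @[n --> \oo]
      --> nu (fun N => rgraph_iso (neighbourhood r N) G).

Definition deterministic (R : realType) (N : rgraph) : rgraph_law R :=
  fun A => `[< A N >]%:R.

Definition net_mark n (N : network n) (v : vertex N) : vtype :=
  if is_root (arc N) v then Root else if is_tree (arc N) v then Tree
  else if is_retic (arc N) v then Retic else Leaf.

Definition rooted_at n (N : network n) (v : vertex N) : rgraph :=
  RGraph (fun u w => arc N u w) (@net_mark n N) v.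

(* [q v] is the conditional probability of [u_n = v] given [N_n = N]. Without
   tree vertices, [u_n] is arbitrary, so [q] is then any probability vector. *)
Definition uniform_tree_vertex (R : realType) n (N : network n)
    (q : vertex N -> R) : Prop :=
  [/\ forall v, 0 <= q v, \sum_v q v = 1 &
    (exists v, is_tree (arc N) v) -> forall v,
      q v = if is_tree (arc N) v then #|[pred u | is_tree (arc N) u]|%:R^-1 else 0].

(* The law of [(N_n, u_n)], where [N_n] is a uniform isomorphism class and [q N]
   is the conditional law of [u_n] given [N_n = N]. *)
Definition random_network_law (R : realType) n
    (q : forall N : network n, vertex N -> R) : rgraph_law R :=
  fun A => \sum_(N in network_reps n) #|network_reps n|%:R^-1 *
    \sum_(v : vertex N) q N v * `[< A (rooted_at v) >]%:R.

(* [Chain k] is [p_k]. The vertex of index [k] on the spine created when [x] is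
   decorated is [w(x)] if [k = 0] and [Side x k] otherwise: the spine is indexed
   by [int] with [w(x)] at index 0, and its other vertices are decorated. *)
Inductive decorated :=
  | Chain of int
  | Side of decorated & {k : int | k != 0}.

Inductive chain_vertex :=
  | Dec of decorated    (* the decorated tree vertex [x] itself *)
  | W of decorated      (* [w(x)] *)
  | Rho of decorated    (* [rho(x)] *)
  | Ell of decorated.   (* [l(x)] *)

Definition side_spine (x : decorated) (k : int) : chain_vertex :=
  if insub k is Some j then Dec (Side x j) else W x.

Inductive chain_arc : chain_vertex -> chain_vertex -> Prop :=
  | arc_main k : chain_arc (Dec (Chain k)) (Dec (Chain (k + 1)))
  | arc_side x k : chain_arc (side_spine x k) (side_spine x (k + 1))
  | arc_decorated_rho x : chain_arc (Dec x) (Rho x)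
  | arc_w_rho x : chain_arc (W x) (Rho x)
  | arc_rho_leaf x : chain_arc (Rho x) (Ell x).

Definition chain_mark (v : chain_vertex) : vtype :=
  match v with Dec _ | W _ => Tree | Rho _ => Retic | Ell _ => Leaf end.

Definition decorated_chain : rgraph :=
  RGraph chain_arc chain_mark (Dec (Chain 0)).

(* Main.v *)
From mathcomp Require Import all_boot all_order all_algebra.
From mathcomp Require Import zify.
From mathcomp Require Import all_classical all_reals all_analysis.
Require Import Defs.
Set Implicit Arguments.
Unset Strict Implicit.
Unset Printing Implicit Defensive.
Import Order.TTheory GRing.Theory Num.Theory.

(** No enumeration of networks is needed. Every estimate is a sum over class representatives,
    compared with another such sum through an injective relation between pairs (network, marks);
    probabilities appear only at the end. Both surgeries keep the set of leaf labels, even the one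
    that adds two vertices, so the two sides of a comparison range over the same networks. Rigidity
    upgrades an isomorphism matching the marks to an equality of marked representatives, which is
    what injectivity requires. There are always at least [n - 1] tree vertices, so it suffices that
    the exceptional ones are [o(n)] on average. The cutoff [J] is fixed before [n] grows: it makes
    the contribution [4 n / J] of long chains a small fraction of [n], while everything else is
    bounded in terms of [J]. Only cycles through a tree vertex and its reticulation child have to be
    excluded: acyclicity prevents a reduced walk from closing up along one spine, so a shortest
    closed walk must cross a reticulation. *)

(* Networks are rigid, so uniform isomorphism classes can be compared by double counting.
   Moving a tree vertex [w] with its reticulation child to another arc between vertices
   that are not reticulations can be done in about [2 n] ways; if [w] is on a short cycle
   through its reticulation child then the old place of [w] is still close to it after
   the move, so the move can be undone in boundedly many ways per vertex. Hence a network
   has on average a bounded number of such cycles of given length. A tree leaf at the end of a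
   chain of at most [J] vertices hanging from a branching vertex can be turned into a
   leaf below a reticulation so as to create a cycle of length at most [J + 3], so there
   are boundedly many such tree leaves on average as well, while at most [4 n / J] tree
   leaves end a longer chain. There is one branching vertex less than tree leaves, so most tree
   vertices are far from the root, from tree leaves, from branching vertices and from short
   cycles. Around such a vertex the network coincides with its universal cover, whose tree
   vertices are the reduced words in the moves down, up and across a reticulation: this is
   the decorated chain. *)

(** * Vertices of a simplex tree-child network *)

Lemma card2_mem (T : finType) (A : pred T) x y z :
  #|A| = 2 -> A x -> A y -> x != y -> A z -> z = x \/ z = y.
Proof.
move=> A2 Ax Ay xy Az; have [->|zx] := eqVneq z x; first by left.
have [->|zy] := eqVneq z y; first by right.
have /uniq_leq_size : uniq [:: x; y; z].
  by rewrite /= !inE negb_or xy eq_sym zx eq_sym zy.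
move=> /(_ (enum A)); rewrite -cardE A2 => h; suff: 3 <= 2 by [].
by apply: h => t; rewrite !inE mem_enum => /or3P[] /eqP->.
Qed.

Section Graph.
Variables (V : finType) (E : rel V).

Lemma in_unique v u u' : (degree E v).1 = 1 -> E u v -> E u' v -> u = u'.
Proof.
rewrite /degree /= => /eq_leq /card_le1_eqP h Eu Eu'.
by apply: h; rewrite inE.
Qed.

Lemma out_unique v u u' : (degree E v).2 = 1 -> E v u -> E v u' -> u = u'.
Proof.
rewrite /degree /= => /eq_leq /card_le1_eqP h Eu Eu'.
by apply: h; rewrite inE.
Qed.

Lemma in_exists v : 0 < (degree E v).1 -> exists u, E u v.
Proof. by rewrite /degree /= => /card_gt0P[u]; exists u. Qed.

Lemma out_exists v : 0 < (degree E v).2 -> exists u, E v u.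
Proof. by rewrite /degree /= => /card_gt0P[u]; exists u. Qed.

Lemma out0 v u : (degree E v).2 = 0 -> ~~ E v u.
Proof. by rewrite /degree /= => /card0_eq /(_ u); rewrite inE => ->. Qed.

Lemma in0 v u : (degree E v).1 = 0 -> ~~ E u v.
Proof. by rewrite /degree /= => /card0_eq /(_ u); rewrite inE => ->. Qed.

(** A height increasing along arcs yields acyclicity and also reachability: every vertex but the
    root has a parent, which is lower, so climbing ends at the root. The surgeries below only have
    to supply such a height. *)
Lemma simplex_intro n (lab : 'I_n -> V) (h : V -> nat) :
  (forall u v, E u v -> h u < h v) ->
  (exists2 o, is_root E o &
     forall v, v != o -> v \notin codom lab -> is_tree E v || is_retic E v) ->
  injective lab -> (forall i, is_leaf E (lab i)) ->
  (forall v, ~~ is_leaf E v -> exists2 u, E v u & is_tree E u || is_leaf E u) ->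
  (forall v u, is_retic E v -> E v u -> is_leaf E u) ->
  simplex_tree_child E lab.
Proof.
move=> hE [z ro ho] li ll tc oc; split => //.
- move=> u v /hE uv; apply/negP => /connectP[p pp e].
  have : h v <= h u.
    rewrite e; elim: p v pp {e uv} => //= x p IH v /andP[/hE /ltnW vx /IH].
    exact: leq_trans.
  by rewrite leqNgt uv.
- exists z; split => // v; have [k] := ubnP (h v).
  elim: k v => // k IH v; rewrite ltnS => hk.
  have [->|vo] := eqVneq v z; first exact: connect0.
  have /in_exists[u uv] : 0 < (degree E v).1.
    have [/codomP[i ->]|/(ho v vo)] := boolP (v \in codom lab).
      by rewrite (eqP (ll i)).
    by case/orP=> /eqP->.
  apply: connect_trans (connect1 uv); apply: IH.
  exact: leq_trans (hE _ _ uv) hk.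
Qed.

Definition adj : rel V := fun u v => E u v || E v u.

Lemma adjC u v : adj u v = adj v u.
Proof. by rewrite /adj orbC. Qed.

Definition point v := is_tree E v && [exists r, E v r && is_retic E r].

Definition branching v := is_tree E v && ~~ [exists r, E v r && is_retic E r].

Definition tree_leaf l := is_leaf E l && [exists z, E z l && ~~ is_retic E z].

(** The local condition under which the moves down, up and across a reticulation all lead from [v]
    to a tree vertex. *)
Definition nice v := is_tree E v && [&& [exists a, E a v && is_tree E a],
  [exists c, E v c && is_tree E c] & [exists r, E v r && is_retic E r]].

(* [w] lies on an undirected cycle through its reticulation child, of length at
   most [L + 2]. *)
Definition bad L w := is_tree E w /\ exists r p, [/\ E w r, is_retic E r,
  path adj r p, w \notin p & size p <= L] /\
  (E (last r p) w \/ E w (last r p) && ~~ is_retic E (last r p)).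

Fixpoint fball k v : {set V} :=
  if k is k'.+1 then
    fball k' v :|: \bigcup_(u in fball k' v) [set x | adj u x]%SET else [set v]%SET.

Lemma fball_center k v : v \in fball k v.
Proof. by elim: k => [|k IH] /=; rewrite inE ?IH. Qed.

Lemma fball_step k v u x : u \in fball k v -> adj u x -> x \in fball k.+1 v.
Proof.
move=> hu ux /=; rewrite inE; apply/orP; right.
by apply/bigcupP; exists u; rewrite ?inE.
Qed.

Lemma fball_mono k k' v : k <= k' -> fball k v \subset fball k' v.
Proof.
move=> /subnKC <-; elim: (k' - k) => [|d IH]; first by rewrite addn0.
by rewrite addnS /=; apply: fintype.subset_trans IH (finset.subsetUl _ _).
Qed.

Lemma fball_path k v u p : u \in fball k v -> path adj u p ->
  last u p \in fball (k + size p) v.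
Proof.
elim: p k u => [|x p IH] k u /= hu; first by rewrite addn0.
move=> /andP[ux pp]; rewrite addnS -addSn; apply: IH pp.
exact: fball_step ux.
Qed.

Lemma fball_sym k u v : u \in fball k v -> v \in fball k u.
Proof.
move=> h; have [p [pp sp lp]] : exists p, [/\ path adj v p, size p <= k & last v p = u].
  elim: k u h => [|k IH] u /=; rewrite inE; first by move=> /eqP->; exists [::].
  case/orP=> [/IH[p [? h ?]]|/bigcupP[x /IH[p [pp sp lp]]]].
    by exists p; split=> //; exact: leqW.
  by rewrite inE => xu; exists (rcons p u); rewrite rcons_path pp lp size_rcons last_rcons.
have : path adj u (rev (belast v p)).
  by rewrite -lp rev_path; apply: sub_path pp => x y; rewrite adjC.
move=> /(fball_path (fball_center 0 u)); rewrite size_rev size_belast add0n.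
have -> : last u (rev (belast v p)) = v.
  by case: p {pp sp} lp => [<-//|x p _]; rewrite /= rev_cons last_rcons.
exact/fintype.subsetP/fball_mono.
Qed.

End Graph.

Section Network.
Variables (n : nat) (V : finType) (E : rel V) (lab : 'I_n -> V).
Hypothesis H : simplex_tree_child E lab.

Lemma leafE v : is_leaf E v = (v \in codom lab).
Proof.
apply/idP/idP => [/eqP dv|/codomP[i ->]]; last exact: stc_lab_leaf H i.
have [z [/eqP ro _ ho]] := stc_rooted H.
apply: contraT => vl; have vo : v != z by apply/eqP => vo; rewrite vo ro in dv.
by have := ho v vo vl; rewrite /is_tree /is_retic dv.
Qed.

Lemma vertex_cases v :
  [\/ is_root E v, is_tree E v, is_retic E v | is_leaf E v].
Proof.
have [z [ro _ ho]] := stc_rooted H.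
have [->|vz] := eqVneq v z; first by constructor 1.
have [|nl] := boolP (is_leaf E v); first by constructor 4.
rewrite leafE in nl.
by case/orP: (ho v vz nl); [constructor 2|constructor 3].
Qed.

Lemma root_unique u v : is_root E u -> is_root E v -> u = v.
Proof.
have [z [ro _ ho]] := stc_rooted H.
suff rE x : is_root E x -> x = z by move=> /rE-> /rE->.
move=> rx; apply/eqP; apply: contraLR rx => /ho; rewrite -leafE /is_root.
have [/eqP->//|_ /(_ isT)] := boolP (is_leaf E x).
by case/orP=> /eqP->.
Qed.

(** The number of ancestors serves as a canonical height. *)
Definition rank v := #|[pred u | connect E u v]|.

Lemma rank_lt u v : E u v -> rank u < rank v.
Proof.
move=> uv; apply/proper_card/properP; split.
  apply/fintype.subsetP => x; rewrite !inE => xu.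
  exact: connect_trans xu (connect1 uv).
exists v; rewrite !inE ?connect0 //.
by apply: (stc_acyclic H).
Qed.

Lemma arc_irrefl u : ~~ E u u.
Proof. by apply/negP => /rank_lt; rewrite ltnn. Qed.

Lemma retic_child v u : is_retic E v -> E v u -> is_leaf E u.
Proof. by move=> rv vu; apply: (stc_one_component H rv vu). Qed.

Lemma leaf_out v u : is_leaf E v -> ~~ E v u.
Proof. by move=> /eqP d; apply: out0; rewrite d. Qed.

Lemma tree_child v : ~~ is_leaf E v -> exists2 u, E v u & is_tree E u || is_leaf E u.
Proof. exact: (stc_tree_child H). Qed.

Lemma tree_nretic v : is_tree E v -> ~~ is_retic E v.
Proof. by rewrite /is_retic => /eqP->. Qed.

Lemma leaf_nretic v : is_leaf E v -> ~~ is_retic E v.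
Proof. by rewrite /is_retic => /eqP->. Qed.

Lemma tree_nleaf v : is_tree E v -> ~~ is_leaf E v.
Proof. by rewrite /is_leaf => /eqP->. Qed.

Lemma retic_nleaf v : is_retic E v -> ~~ is_leaf E v.
Proof. by rewrite /is_leaf => /eqP->. Qed.

Lemma root_nretic v : is_root E v -> ~~ is_retic E v.
Proof. by rewrite /is_retic => /eqP->. Qed.

Lemma tree_or_leaf_nretic v : is_tree E v || is_leaf E v -> ~~ is_retic E v.
Proof. by case/orP=> [/tree_nretic|/leaf_nretic]. Qed.

Lemma arc_head_nretic u v : E u v -> ~~ is_retic E v -> is_tree E v || is_leaf E v.
Proof.
move=> uv nr; case: (vertex_cases v) => [rv|->//|rv|->]; last by rewrite orbT.
  by have := @in0 _ E v u; rewrite (eqP rv) uv => /(_ erefl).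
by rewrite rv in nr.
Qed.

(** The root is excluded because its only child is a tree vertex or a leaf by the tree-child
    condition, a reticulation because its child is a leaf. *)
Lemma retic_parent u r : is_retic E r -> E u r -> is_tree E u.
Proof.
move=> rr ur; case: (vertex_cases u) => // [hu|hu|hu].
- have nl : ~~ is_leaf E u by rewrite /is_leaf (eqP hu).
  have [x ux hx] := tree_child nl.
  have xr : x = r by apply: out_unique ux ur; rewrite (eqP hu).
  by rewrite -xr (negPf (tree_or_leaf_nretic hx)) in rr.
- by have := retic_nleaf rr; rewrite (retic_child hu ur).
- by rewrite (negPf (leaf_out _ hu)) in ur.
Qed.

Lemma tree_parent u t : is_tree E t -> E u t -> is_root E u || is_tree E u.
Proof.
move=> tt ut; case: (vertex_cases u) => [->//|->|hu|hu]; first by rewrite orbT.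
  by have := tree_nleaf tt; rewrite (retic_child hu ut).
by rewrite (negPf (leaf_out _ hu)) in ut.
Qed.

Lemma tree_or_leaf_in1 v : is_tree E v || is_leaf E v -> (degree E v).1 = 1.
Proof. by case/orP=> /eqP->. Qed.

Lemma parent_unique u u' v : ~~ is_retic E v -> E u v -> E u' v -> u = u'.
Proof.
move=> nr uv; apply: (in_unique _ uv); apply: tree_or_leaf_in1.
exact: arc_head_nretic uv nr.
Qed.

Lemma retic_child_unique v r r' :
  E v r -> is_retic E r -> E v r' -> is_retic E r' -> r = r'.
Proof.
move=> vr rr vr' rr'; have tv := retic_parent rr vr.
have [c vc hc] := tree_child (tree_nleaf tv).
apply/eqP/negPn/negP => rr'n.
have := @card2_mem _ [pred u | E v u] r r' c _ vr vr' rr'n vc.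
case; first by have := eqP tv; rewrite /degree => -[].
  by move=> e; rewrite -e (negPf (tree_or_leaf_nretic hc)) in rr.
by move=> e; rewrite -e (negPf (tree_or_leaf_nretic hc)) in rr'.
Qed.

Lemma nonretic_child_unique v r c c' : E v r -> is_retic E r ->
  E v c -> ~~ is_retic E c -> E v c' -> ~~ is_retic E c' -> c = c'.
Proof.
move=> vr rr vc nc vc' nc'; have tv := retic_parent rr vr.
apply/eqP/negPn/negP => ccn.
have := @card2_mem _ [pred u | E v u] c c' r _ vc vc' ccn vr.
case; first by have := eqP tv; rewrite /degree => -[].
  by move=> e; rewrite e (negPf nc) in rr.
by move=> e; rewrite e (negPf nc') in rr.
Qed.

(** Induction from the leaves upwards: a vertex that is not a leaf has a child of indegree 1, fixed
    by induction, and is determined as the only parent of that child. *)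
Lemma rigid (f : V -> V) : injective f -> (forall u v, E (f u) (f v) = E u v) ->
  (forall i, f (lab i) = lab i) -> forall v, f v = v.
Proof.
move=> fi fE fl v.
have [k] := ubnP (#|V| - rank v); elim: k v => // k IH v; rewrite ltnS => hk.
have [|nl] := boolP (is_leaf E v); first by rewrite leafE => /codomP[i ->].
have [u vu hu] := tree_child nl.
have fu : f u = u.
  apply: IH; have := rank_lt vu; have := max_card [pred x | connect E x u].
  by rewrite -/(rank u); move: (rank u) (rank v) #|V| hk => a b c; lia.
apply: (in_unique (tree_or_leaf_in1 hu) _ vu).
by rewrite -{1}fu fE.
Qed.

Lemma adj_deg v : #|[set x | adj E v x]%SET| <= 3.
Proof.
have -> : [set x | adj E v x]%SET = ([set x | E v x] :|: [set x | E x v])%SET.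
  by apply/setP => x; rewrite !inE.
apply: leq_trans (_ : (degree E v).2 + (degree E v).1 <= 3).
  by rewrite cardsU /degree /= !cardsE leq_subr.
by case: (vertex_cases v) => /eqP->.
Qed.

Lemma card_fball k v : #|fball E k v| <= 4 ^ k.
Proof.
elim: k => [|k IH] /=; first by rewrite cards1.
apply: (@leq_trans (4 * #|fball E k v|)); last by rewrite expnS leq_mul2l IH orbT.
rewrite cardsU; apply: leq_trans (leq_subr _ _) _.
rewrite (mulSn 3) leq_add2l.
apply: leq_trans (_ : \sum_(u in fball E k v) #|[set x | adj E u x]%SET| <= _).
  elim/big_rec2: _ => [|u A B _ h]; first by rewrite cards0.
  by rewrite cardsU; apply: leq_trans (leq_subr _ _) _; rewrite leq_add2l.
rewrite mulnC -sum_nat_const; apply: leq_sum => u _; exact: adj_deg.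
Qed.

End Network.

(** * Isomorphism classes *)

Section Iso.
Variables (V V' : finType) (E : rel V) (E' : rel V') (f : V -> V').
Hypotheses (fb : bijective f) (fE : forall u v, E' (f u) (f v) = E u v).

Lemma degree_iso v : degree E' (f v) = degree E v.
Proof.
have [g fK gK] := fb; rewrite /degree; congr pair.
  rewrite -(fintype.card_image (can_inj fK)); apply: eq_card => u.
  apply/idP/fintype.imageP => [|[w]]; rewrite !inE.
    by move=> h; exists (g u); rewrite ?gK // inE -fE gK.
  by move=> h ->; rewrite fE.
rewrite -(fintype.card_image (can_inj fK)); apply: eq_card => u.
apply/idP/fintype.imageP => [|[w]]; rewrite !inE.
  by move=> h; exists (g u); rewrite ?gK // inE -fE gK.
by move=> h ->; rewrite fE.
Qed.

Lemma adj_iso u v : adj E' (f u) (f v) = adj E u v.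
Proof. by rewrite /adj !fE. Qed.

Lemma fball_iso k u v : v \in fball E k u -> f v \in fball E' k (f u).
Proof.
elim: k v => [|k IH] v /=; rewrite inE; first by move=> /eqP->; rewrite inE.
case/orP=> [/IH|/bigcupP[x /IH xk]].
  exact/fintype.subsetP/(fball_mono E' _ (leqnSn k)).
by rewrite inE -adj_iso; exact: (fball_step xk).
Qed.

Lemma bad_iso L w : bad E L w -> bad E' L (f w).
Proof.
have fi := bij_inj fb.
move=> [tw [r [p [[wr rr pp wp sp] hl]]]]; split; first by rewrite /is_tree degree_iso.
exists (f r), (map f p); rewrite last_map !fE /is_retic !degree_iso; split=> //.
split=> //; last by rewrite size_map.
  by rewrite path_map; apply: sub_path pp => x y; rewrite /= adj_iso.
by rewrite mem_map.
Qed.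

End Iso.

Section NetIso.
Variable n : nat.

Lemma net_iso_refl (V : finType) (E : rel V) (lab : 'I_n -> V) : net_iso E E lab lab.
Proof. by exists id; split => //; exists id. Qed.

Lemma net_iso_sym (V V' : finType) (E : rel V) (E' : rel V') (lab : 'I_n -> V)
    (lab' : 'I_n -> V') : net_iso E E' lab lab' -> net_iso E' E lab' lab.
Proof.
move=> [f [[g fK gK] fE fl]]; exists g; split; first by exists f.
  by move=> u v; rewrite -fE !gK.
by move=> i; rewrite -fl fK.
Qed.

Lemma net_iso_trans (V V' V'' : finType) (E : rel V) (E' : rel V') (E'' : rel V'')
    (lab : 'I_n -> V) (lab' : 'I_n -> V') (lab'' : 'I_n -> V'') :
  net_iso E E' lab lab' -> net_iso E' E'' lab' lab'' -> net_iso E E'' lab lab''.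
Proof.
move=> [f [fb fE fl]] [g [gb gE gl]]; exists (g \o f); split.
- exact: bij_comp.
- by move=> u v /=; rewrite gE fE.
- by move=> i /=; rewrite fl gl.
Qed.

Lemma network_simplex (N : network n) : simplex_tree_child (arc N) (label N).
Proof. by have /asboolP := valP N. Qed.

Let iso_equiv : {in [set: network n]%SET & &, equivalence_rel (@network_iso n)}.
Proof.
move=> N1 N2 N3 _ _ _; split; first by apply/asboolP; exact: net_iso_refl.
move=> /asboolP h12; apply/asboolP/asboolP => h; last exact: net_iso_trans h12 h.
exact: net_iso_trans (net_iso_sym h12) h.
Qed.

Let P := equivalence_partition (@network_iso n) [set: network n]%SET.

Let pP : finset.partition P [set: network n]%SET.
Proof. exact: equivalence_partitionP. Qed.

Let trP : is_transversal (network_reps n) P [set: network n]%SET.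
Proof. exact: transversalP. Qed.

Lemma reps_unique (N1 N2 : network n) : N1 \in network_reps n -> N2 \in network_reps n ->
  net_iso (arc N1) (arc N2) (label N1) (label N2) -> N1 = N2.
Proof.
move=> r1 r2 h; apply: (pblock_inj trP) => //.
apply/eqP; rewrite eq_pblock ?(partition_trivIset pP) //; last first.
  by rewrite (cover_partition pP) finset.inE.
by rewrite /P pblock_equivalence_partition ?finset.inE //; exact/asboolP.
Qed.

Lemma reps_complete (V : finType) (E : rel V) (lab : 'I_n -> V) :
  simplex_tree_child E lab -> exists N, N \in network_reps n /\
    net_iso E (arc N) lab (label N).
Proof.
move=> /network_complete[N hN].
have Nc : N \in finset.cover P by rewrite (cover_partition pP) finset.inE.
pose M := transversal_repr N (network_reps n) (finset.pblock P N).
have PN : finset.pblock P N \in P by rewrite pblock_mem.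
exists M; split; first exact: (repr_mem_transversal trP _ PN).
have MN : M \in finset.pblock P N by exact: repr_mem_pblock trP _ _ PN.
apply: net_iso_trans hN _; apply/asboolP.
by move: MN; rewrite /P pblock_equivalence_partition ?finset.inE.
Qed.

(** Between representatives the isomorphism is a mere transport, so corresponding marks become
    equal. *)
Lemma rigid_iso (N1 N2 : network n) (g : vertex N1 -> vertex N2) :
  N1 \in network_reps n -> N2 \in network_reps n ->
  bijective g -> (forall u v, arc N2 (g u) (g v) = arc N1 u v) ->
  (forall i, g (label N1 i) = label N2 i) ->
  exists e : N1 = N2, forall v, g v = eq_rect N1 (fun N => vertex N) v N2 e.
Proof.
move=> r1 r2 gb gE gl.
have e : N1 = N2 by apply: reps_unique => //; exists g.
subst N2; exists erefl => v /=.
exact: (rigid (network_simplex N1) (bij_inj gb) gE gl).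
Qed.

End NetIso.


(** A relation replaces an injection because the target of a surgery is only known to exist. In the
    proof [option Y] makes the chosen function total even if [Y] is empty. *)
Lemma leq_card_fibre (X Y : finType) (PX : pred X) (PY : pred Y) (S : X -> Y -> Prop) :
  (forall x, PX x -> exists2 y, PY y & S x y) ->
  (forall x x' y, PX x -> PX x' -> S x y -> S x' y -> x = x') -> #|PX| <= #|PY|.
Proof.
move=> hS uS.
have [F hF] : {F : X -> option Y & forall x, PX x -> exists2 y, PY y & F x = Some y /\ S x y}.
  exists (fun x => if pselect (exists2 y, PY y & S x y) is left e
                 then Some (s2val (cid2 e)) else None) => x /hS.
  by case: pselect => // e _; case: cid2 => y ? ?; exists y.
rewrite -(card_imset PY Some_inj) -(@card_in_imset _ _ F); last first.
  move=> x x' Px Px'.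
  have [y _ [-> Sy]] := hF x Px; have [y' _ [-> Sy']] := hF x' Px'.
  by case=> yy; subst y'; exact: uS Sy Sy'.
apply/subset_leq_card/fintype.subsetP => _ /imsetP[x Px ->].
by have [y Py [-> _]] := hF x Px; apply: imset_f.
Qed.

(** The form used for double counting: both sums are cardinals of sets of dependent pairs of a
    network and a mark in it. *)
Lemma leq_sum_card_fibre (I : finType) (D : {set I}) (A B : I -> finType)
    (PA : forall i, pred (A i)) (PB : forall i, pred (B i))
    (S : forall i, A i -> forall j, B j -> Prop) :
  (forall i a, i \in D -> PA i a -> exists j b, [/\ j \in D, PB j b & S i a j b]) ->
  (forall i1 a1 i2 a2 j b, i1 \in D -> i2 \in D -> S i1 a1 j b -> S i2 a2 j b ->
     existT A i1 a1 = existT A i2 a2) ->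
  \sum_(i in D) #|PA i| <= \sum_(j in D) #|PB j|.
Proof.
move=> hS uS.
have cardT (C : I -> finType) (PC : forall i, pred (C i)) :
    \sum_(i in D) #|PC i| =
    #|[pred x : {i : I & C i} | (tag x \in D) && PC (tag x) (tagged x)]|.
  under eq_bigr do rewrite -sum1_card.
  by rewrite sig_big_dep -sum1_card.
rewrite !cardT.
apply: (@leq_card_fibre _ _ _ _
  (fun x y => S (tag x) (tagged x) (tag y) (tagged y))) => [[i a]|[i a] [i' a'] [j b]] /=.
  move=> /andP[iD Pa]; have [j [b [jD Pb Sab]]] := hS i a iD Pa.
  by exists (existT B j b) => //=; rewrite jD.
by move=> /andP[iD _] /andP[iD' _]; exact: uS.
Qed.

(** * Regrafting and short cycles *)

(** Regrafting amounts to permuting cyclically the incoming arcs of three vertices of indegree 1.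
    Degrees are then visibly preserved, and the opposite cycle undoes the move. *)
Definition cycle3 (T : eqType) (a b c v : T) :=
  if v == a then b else if v == b then c else if v == c then a else v.

Lemma cycle3K (T : eqType) (a b c : T) : b != a -> b != c -> c != a ->
  cancel (cycle3 a b c) (cycle3 a c b).
Proof.
move=> ba bc ca v; rewrite /cycle3.
have [->|va] := eqVneq v a; first by rewrite (negPf ba) (negPf bc) eqxx.
have [->|vb] := eqVneq v b; first by rewrite (negPf ca) eqxx.
have [->|vc] := eqVneq v c; first by rewrite eqxx.
by rewrite (negPf va) (negPf vb) (negPf vc).
Qed.

(* Regrafting: the tree vertex [w], with its reticulation child [r], is removed from
   the arc between its parent and its other child [c] and inserted in the arc [x -> y]. *)
Section Move.
Variables (n : nat) (V : finType) (E : rel V) (lab : 'I_n -> V) (w r c x y : V).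
Hypotheses (H : simplex_tree_child E lab) (wr : E w r) (rr : is_retic E r)
  (wc : E w c) (nc : ~~ is_retic E c) (xy : E x y) (nx : ~~ is_retic E x)
  (ny : ~~ is_retic E y) (yw : y != w) (yc : y != c).

Definition moved : rel V := fun u v => E u (cycle3 w y c v).

Let tw : is_tree E w. Proof. exact: (retic_parent H rr wr). Qed.

Let cw : c != w.
Proof. by apply: contraTneq wc => ->; exact: (arc_irrefl H). Qed.

Let sK : cancel (cycle3 w y c) (cycle3 w c y). Proof. exact: cycle3K. Qed.

Let sV v : [\/ v = w, v = y, v = c | [/\ v != w, v != y, v != c & cycle3 w y c v = v]].
Proof.
rewrite /cycle3; have [->|?] := eqVneq v w; first by constructor 1.
have [->|?] := eqVneq v y; first by constructor 2.
by have [->|?] := eqVneq v c; [constructor 3|constructor 4].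
Qed.

Let sw : cycle3 w y c w = y. Proof. by rewrite /cycle3 eqxx. Qed.
Let sy : cycle3 w y c y = c. Proof. by rewrite /cycle3 (negPf yw) eqxx. Qed.
Let sc : cycle3 w y c c = w.
Proof. by rewrite /cycle3 (negPf cw) [c == y]eq_sym (negPf yc) eqxx. Qed.

Lemma moved_degree v : degree moved v = degree E v.
Proof.
rewrite {2}/degree; have <- : #|[pred u | moved v u]| = #|[pred u | E v u]|.
  rewrite -!sum1_card [RHS](reindex_inj (can_inj sK)).
  by apply: eq_bigl => u; rewrite !inE.
rewrite /degree; congr pair.
have -> : #|[pred u | moved u v]| = (degree E (cycle3 w y c v)).1 by [].
have iw : (degree E w).1 = 1 by rewrite (eqP tw).
have iy : (degree E y).1 = 1 := tree_or_leaf_in1 (arc_head_nretic H xy ny).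
have ic : (degree E c).1 = 1 := tree_or_leaf_in1 (arc_head_nretic H wc nc).
by case: (sV v) => [->|->|->|[_ _ _ ->]] //; rewrite ?sw ?sy ?sc ?iw ?iy ?ic //;
  rewrite -?[#|_|]/((degree E _).1) ?iw ?iy ?ic.
Qed.

Lemma moved_tree v : is_tree moved v = is_tree E v.
Proof. by rewrite /is_tree moved_degree. Qed.
Lemma moved_leaf v : is_leaf moved v = is_leaf E v.
Proof. by rewrite /is_leaf moved_degree. Qed.
Lemma moved_retic v : is_retic moved v = is_retic E v.
Proof. by rewrite /is_retic moved_degree. Qed.

Let xw : x != w.
Proof.
apply: contraNneq yc => xw; have wy := xy; rewrite xw in wy.
by rewrite (nonretic_child_unique H wr rr wy ny wc nc).
Qed.

Lemma moved_keep u v : E u v -> u != w -> v != w -> v != y -> moved u v.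
Proof.
move=> uv uw vw vy; rewrite /moved.
case: (sV v) => [e|e|e|[_ _ _ ->//]]; rewrite ?e ?eqxx // in vw vy *.
by rewrite e in uv; rewrite (parent_unique H nc uv wc) eqxx in uw.
Qed.

Lemma moved_above u : E u w -> moved u c.
Proof. by rewrite /moved sc. Qed.

Lemma moved_retic_arc u v : is_retic E v -> moved u v = E u v.
Proof.
rewrite /moved => rv; case: (sV v) => [e|e|e|[_ _ _ ->//]].
- by rewrite e (negPf (tree_nretic tw)) in rv.
- by rewrite e (negPf ny) in rv.
- by rewrite e (negPf nc) in rv.
Qed.

Lemma moved_below : moved w y. Proof. by rewrite /moved sy. Qed.

Lemma movedK u v : E u v = moved u (cycle3 w c y v).
Proof.
by rewrite /moved cycle3K // 1?eq_sym.
Qed.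

Lemma moved_simplex : simplex_tree_child moved lab.
Proof.
have nret v : v \in [:: w; y; c] -> ~~ is_retic E v.
  by rewrite !inE => /or3P[] /eqP-> //; exact: tree_nretic.
have sin v : v \in [:: w; y; c] -> cycle3 w y c v \in [:: w; y; c].
  by rewrite !inE => /or3P[] /eqP->; rewrite ?sw ?sy ?sc eqxx ?orbT.
have nrp u v : v \in [:: w; y; c] -> E u v -> ~~ is_retic E u.
  move=> vin uv; have nv := nret _ vin; move: vin uv; rewrite !inE => /or3P[] /eqP e uv.
  - rewrite e in uv; have := tree_parent H tw uv.
    by case/orP=> [/root_nretic|/tree_nretic].
  - by rewrite e in uv; rewrite (parent_unique H ny uv xy).
  - by rewrite e in uv; rewrite (parent_unique H nc uv wc) tree_nretic.
have retic_arc u v : moved u v -> is_retic E u -> v \notin [:: w; y; c] /\ E u v.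
  move=> uv ru; case: (sV v) => [e|e|e|[h1 h2 h3 e]]; last first.
    by rewrite /moved e in uv; split; rewrite // !inE !negb_or h1 h2.
  1-3: have vin : v \in [:: w; y; c] by rewrite e !inE eqxx ?orbT.
  1-3: by have := nrp u _ (sin v vin) uv; rewrite ru.
(* Ranks are doubled to free an odd value for [w], just above its new parent [x] and below its new
   child [y]. Reticulations and leaves can be lifted to the top, since arcs leaving a reticulation
   end in leaves. *)
pose h v := if is_leaf E v then (#|V|.*2 + 3).+1 else
  if is_retic E v then #|V|.*2 + 3 else
  if v == w then (rank E x).*2.+1 else (rank E v).*2.
have hr v : rank E v <= #|V| := max_card _.
have [z [rz _ hz]] := stc_rooted H.
apply: (@simplex_intro _ _ _ lab h).
- move=> u v uv; rewrite /h.
  have -> : is_leaf E u = false by apply/negP => lu; move: uv; rewrite /moved (negPf (leaf_out _ lu)).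
  have [lv|nlv] := boolP (is_leaf E v).
    by move: (rank E x) (rank E u) #|V| (hr x) (hr u) => i j k; clear; case: (is_retic E u); case: (u == w); lia.
  have [ru|nru] := boolP (is_retic E u).
    by have [_ /(retic_child H ru)] := retic_arc _ _ uv ru; rewrite (negPf nlv).
  have [rv|nrv] := boolP (is_retic E v).
    by move: (rank E x) (rank E u) #|V| (hr x) (hr u) => i j k; clear; case: (u == w); lia.
  case: (sV v) uv => [->|->|->|[h1 h2 h3 e]]; rewrite /moved ?sw ?sy ?sc ?e => uv.
  - by rewrite eqxx (parent_unique H ny uv xy) (negPf xw).
  - rewrite (parent_unique H nc uv wc) eqxx (negPf yw).
    by move: (rank E x) (rank E y) (rank_lt H xy) => i j; clear; lia.
  - have uw : u != w by apply: contraTneq uv => ->; exact: (arc_irrefl H).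
    rewrite (negPf uw) (negPf cw).
    by move: (rank E u) (rank E w) (rank E c) (rank_lt H uv) (rank_lt H wc) => i j k; clear; lia.
  - rewrite (negPf h1); case: eqVneq => [uw|_]; last first.
      by move: (rank E u) (rank E v) (rank_lt H uv) => i j; clear; lia.
    by rewrite uw in uv; rewrite (nonretic_child_unique H wr rr uv nrv wc nc) eqxx in h3.
- exists z; first by rewrite /is_root moved_degree.
  by move=> v vz vl; rewrite moved_tree moved_retic hz.
- exact: (stc_lab_inj H).
- by move=> i; rewrite moved_leaf (stc_lab_leaf H).
- move=> v; rewrite moved_leaf => /(tree_child H)[u vu hu].
  exists (cycle3 w c y u); first by rewrite -movedK.
  rewrite moved_tree moved_leaf.
  have [uin|uin] := boolP (u \in [:: w; y; c]).
    have : cycle3 w c y u \in [:: w; y; c].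
      rewrite /cycle3; move: uin; rewrite !inE => /or3P[] /eqP->;
      by rewrite ?eqxx ?(negPf yw) ?(negPf cw) ?(negPf yc) ?orbT ?eqxx ?orbT.
    rewrite !inE => /or3P[] /eqP ->; rewrite ?tw //.
      exact: (arc_head_nretic H xy ny).
    exact: (arc_head_nretic H wc nc).
  move: uin; rewrite !inE !negb_or => /and3P[h1 h2 h3].
  by rewrite /cycle3 (negPf h1) (negPf h2) (negPf h3).
- move=> v u; rewrite moved_retic moved_leaf => rv vu.
  by have [_ /(retic_child H rv)] := retic_arc _ _ vu rv.
Qed.

End Move.

(** * Counting vertices by their degrees *)

Section Counts.
Variables (n : nat) (V : finType) (E : rel V) (lab : 'I_n -> V).
Hypothesis H : simplex_tree_child E lab.

Lemma sum_pred (P : pred V) : \sum_v (P v : nat) = #|P|.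
Proof. by rewrite -big_mkcond /= sum1_card. Qed.

Let one_root : \sum_v (is_root E v : nat) = 1.
Proof.
have [z [rz _ _]] := stc_rooted H.
rewrite (bigD1 z) //= rz big1 ?addn0 // => v vz.
by apply/eqP; rewrite eqb0; apply: contra vz => rv; rewrite (root_unique H rv rz).
Qed.

Let leaves : \sum_v (is_leaf E v : nat) = n.
Proof.
rewrite sum_pred (eq_card (leafE H)).
by rewrite card_codom ?card_ord //; exact: (stc_lab_inj H).
Qed.

(** Equating the sums of indegrees and outdegrees gives [t = n - 1 + r] for [t] tree vertices and
    [r] reticulations. *)
Lemma leq_tree_count : n <= #|is_tree E|.+1.
Proof.
have sumE : \sum_v (degree E v).1 = \sum_v (degree E v).2.
  under eq_bigr do rewrite /degree /= -sum1_card big_mkcond /=.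
  under [RHS]eq_bigr do rewrite /degree /= -sum1_card big_mkcond /=.
  by rewrite exchange_big.
have d1 v : (degree E v).1 = is_leaf E v + is_tree E v + is_retic E v * 2.
  rewrite /is_leaf /is_tree /is_retic.
  by case: (vertex_cases H v) => /eqP->.
have d2 v : (degree E v).2 = is_root E v + is_tree E v * 2 + is_retic E v.
  rewrite /is_root /is_tree /is_retic.
  by case: (vertex_cases H v) => /eqP->.
move: sumE; under eq_bigr do rewrite d1; under [RHS]eq_bigr do rewrite d2.
rewrite !big_split -!big_distrl /= leaves one_root -!sum_pred.
move: (\sum_v (is_tree E v : nat)) (\sum_v (is_retic E v : nat)) => a b; clear; lia.
Qed.

Lemma point_children v : is_tree E v ->
  #|[pred u | E v u && ~~ is_retic E u]| + point E v = 2.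
Proof.
move=> tv; have : (degree E v).2 = 2 by rewrite (eqP tv).
rewrite /point tv /= -(cardID (is_retic E)) => <-; rewrite [RHS]addnC; congr addn.
  by apply: eq_card => u; rewrite !inE andbC.
case: (boolP [exists r, E v r && is_retic E r]) => [/existsP[r /andP[vr rr]]|ne] /=; last first.
  symmetry; apply: eq_card0 => u; rewrite !inE; apply/negP => /andP[vu ru].
  by case/negP: ne; apply/existsP; exists u; rewrite vu; exact: ru.
symmetry; rewrite -(card1 r); apply: eq_card => u; rewrite !inE.
apply/andP/eqP => [[vu ru]|->]; last by [].
exact: (retic_child_unique H vu ru vr rr).
Qed.

(** The arcs with no end at a reticulation are counted twice. By heads there is one for each tree
    vertex and each tree leaf; by tails, one for the root, one for each [point] and two for each
    branching vertex. *)
Lemma card_tree_leaf : #|tree_leaf E| = #|branching E|.+1.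
Proof.
pose e u v := [&& E u v, ~~ is_retic E u & ~~ is_retic E v].
have e1 : \sum_v \sum_u (e u v : nat) =
    \sum_v (is_tree E v : nat) + \sum_v (tree_leaf E v : nat).
  rewrite -big_split /=; apply: eq_bigr => v _.
  case: (vertex_cases H v) => kv.
  - rewrite /tree_leaf /is_tree /is_leaf !(eqP kv) big1 // => u _.
    by have /negPf uv : ~~ E u v by [apply: in0; rewrite (eqP kv)]; rewrite /e uv.
  - have /in_exists[u uv] : 0 < (degree E v).1 by rewrite (eqP kv).
    rewrite /tree_leaf kv /is_leaf !(eqP kv) /= (bigD1 u) //= big1 => [|x xu].
      rewrite /e uv (tree_nretic kv) /=.
      by case/orP: (tree_parent H kv uv) => [/root_nretic->|/tree_nretic->].
    apply/eqP; rewrite eqb0; apply: contra xu => /and3P[xv _ _].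
    by rewrite (parent_unique H (tree_nretic kv) xv uv).
  - rewrite /tree_leaf /is_tree /is_leaf !(eqP kv) big1 // => u _.
    by rewrite /e kv !andbF.
  - have /in_exists[u uv] : 0 < (degree E v).1 by rewrite (eqP kv).
    rewrite /tree_leaf kv /is_tree !(eqP kv) /= (bigD1 u) //= big1 => [|x xu].
      rewrite /e uv (leaf_nretic kv) /= add0n addn0 andbT; congr nat_of_bool.
      apply/idP/existsP => [nu|[x /andP[xv]]]; first by exists u; rewrite uv.
      by rewrite (parent_unique H (leaf_nretic kv) uv xv).
    apply/eqP; rewrite eqb0; apply: contra xu => /and3P[xv _ _].
    by rewrite (parent_unique H (leaf_nretic kv) xv uv).
have e2 : \sum_u \sum_v (e u v : nat) + \sum_u (point E u : nat) =
    \sum_u (is_root E u : nat) + (\sum_u (is_tree E u : nat)) * 2.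
  rewrite big_distrl -!big_split /=; apply: eq_bigr => u _.
  rewrite sum_pred; case: (vertex_cases H u) => ku.
  - rewrite /point ku /is_tree (eqP ku) /= addn0 mul0n addn0.
    have d1 : (degree E u).2 = 1 by rewrite (eqP ku).
    rewrite -{}[RHS]d1; apply: eq_card => v; rewrite !inE /e (root_nretic ku) /=.
    apply: andb_idr => uv.
    have nl : ~~ is_leaf E u by rewrite /is_leaf (eqP ku).
    have [x ux hx] := tree_child H nl.
    have <- : x = v by apply: (out_unique _ ux uv); rewrite (eqP ku).
    exact: tree_or_leaf_nretic.
  - rewrite ku /is_root (eqP ku) /= add0n mul1n -[RHS](point_children ku).
    congr addn.
    by apply: eq_card => v; rewrite !inE /e (tree_nretic ku).
  - rewrite /point /is_root /is_tree (eqP ku) /= addn0.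
    by apply: eq_card0 => v; apply/negP => /and3P[_]; rewrite ku.
  - rewrite /point /is_root /is_tree (eqP ku) /= addn0.
    by apply: eq_card0 => v; apply/negP => /and3P[]; rewrite (negPf (leaf_out _ ku)).
have e3 : \sum_u (is_tree E u : nat) = \sum_u (point E u : nat) + \sum_u (branching E u : nat).
  rewrite -big_split; apply: eq_bigr => u _; rewrite /point /branching.
  by case: (is_tree E u) => //=; case: [exists _, _].
move: e2; rewrite exchange_big e1 one_root e3 -!sum_pred.
move: (bigop _ _ _) (bigop _ _ _) (bigop _ _ _) => a b c; clear; lia.
Qed.

End Counts.

(** The path [p] closes the short cycle at a parent of [w] or at [c]. It avoids [y] besides [w], so
    that its arcs survive the move. *)
Definition regraft_site n (N : network n) L (w y : vertex N) : Prop :=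
  let E := arc N in exists r c x p,
  [/\ [/\ E w r, is_retic E r, E w c & ~~ is_retic E c],
      [/\ E x y, ~~ is_retic E x, ~~ is_retic E y, y != w & y != c] &
      [/\ path (adj E) r p, w \notin p, y \notin p, size p <= L &
          E (last r p) w \/ last r p = c]].

Definition regraft n (N : network n) (wy : vertex N * vertex N)
    (N' : network n) (wc : vertex N' * vertex N') : Prop :=
  let E := arc N in let: (w, y) := wy in exists r c x (f : vertex N -> vertex N'),
  [/\ [/\ E w r, is_retic E r, E w c & ~~ is_retic E c],
      [/\ E x y, ~~ is_retic E x, ~~ is_retic E y, y != w & y != c] &
      [/\ bijective f, forall u v, arc N' (f u) (f v) = moved E w c y u v,
          forall i, f (label N i) = label N' i & wc = (f w, f c)]].

(** After the move [w] still reaches [c] by its arc to [r], at most [L] steps along [p], and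
    possibly one more arc, as the old parent of [w] is now the parent of [c]: hence the radius
    [L.+2]. *)
Lemma regraft_exists n (N : network n) L w y : regraft_site L w y ->
  exists (N' : network n) wc, [/\ N' \in network_reps n,
    wc.2 \in fball (arc N') L.+2 wc.1 & regraft (N := N) (w, y) (N' := N') wc].
Proof.
move=> [r [c [x [p [[wr rr wc nc] [xy nx ny yw yc] [pp wp yp sp lp]]]]]].
have HN := network_simplex N.
have Hm := moved_simplex HN wr rr wc nc xy nx ny yw yc.
have [N' [rN' [f [fb fE fl]]]] := reps_complete Hm.
exists N', (f w, f c); split => //; last by exists r, c, x, f.
set E' := moved _ _ _ _ in Hm fE *; suff cb : c \in fball E' L.+2 w by exact: (fball_iso fE cb).
have tw := retic_parent HN rr wr.
have yr : y != r by apply: contraNneq ny => ->.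
have rw : r != w by apply: contraTneq wr => ->; exact: (arc_irrefl HN).
have keep := @moved_keep _ _ _ _ _ _ y HN wc nc.
have pp' : path (adj E') r p.
  have : w \notin r :: p by rewrite inE negb_or eq_sym rw.
  have : y \notin r :: p by rewrite inE negb_or yr.
  elim: p r pp {wr rr rw yr wp yp sp lp} => //= v p IH r /andP[rv pp].
  rewrite !inE !negb_or => /and3P[yr yv yp] /and3P[wr wv wp].
  apply/andP; split; last by apply: IH; rewrite // inE negb_or ?yv ?wv.
  by case/orP: rv => h; apply/orP; [left|right]; apply: keep; rewrite // eq_sym.
have wr' : E' w r by rewrite /E' (moved_retic_arc HN wr rr nc ny _ rr).
have r1 : r \in fball E' 1 w.
  by apply: (fball_step (fball_center E' 0 w)); rewrite /adj wr'.
have lb : last r p \in fball E' (1 + L) w.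
  apply: (fintype.subsetP _ _ (fball_path r1 pp')).
  by apply: fball_mono; rewrite leq_add2l.
case: lp => [lw|<-]; last exact: (fintype.subsetP (fball_mono _ _ (leqnSn _)) _ lb).
apply: (fball_step lb); rewrite /adj.
by rewrite /E' (moved_above HN wc yc lw).
Qed.

(** The marks [w] and [c] suffice to undo the move: [y] is the only child of [w] in the new network
    that is not a reticulation, and the inverse 3-cycle restores the arcs. *)
Lemma regraft_inj n (N1 N2 N' : network n) wy1 wy2 (wc : vertex N' * vertex N') :
  N1 \in network_reps n -> N2 \in network_reps n ->
  regraft (N := N1) wy1 (N' := N') wc -> regraft (N := N2) wy2 (N' := N') wc ->
  existT (fun N : network n => (vertex N * vertex N)%type) N1 wy1 = existT _ N2 wy2.
Proof.
move=> rN1 rN2; case: wy1 wy2 => [w1 y1] [w2 y2].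
move=> [r1 [c1 [x1 [f1 [[wr1 rr1 wc1 nc1] [xy1 nx1 ny1 yw1 yc1] [fb1 fE1 fl1 e1]]]]]].
move=> [r2 [c2 [x2 [f2 [[wr2 rr2 wc2 nc2] [xy2 nx2 ny2 yw2 yc2] [fb2 fE2 fl2 e2]]]]]].
have [g1 f1K g1K] := fb1; have [g2 f2K g2K] := fb2.
have [ew ec] : f1 w1 = f2 w2 /\ f1 c1 = f2 c2 by move: e1; rewrite e2 => -[-> ->].
pose g := g2 \o f1.
have gb : bijective g by apply: bij_comp => //; exists f2.
have gw : g w1 = w2 by rewrite /g /= ew f2K.
have gc : g c1 = c2 by rewrite /g /= ec f2K.
have gE u v : moved (arc N2) w2 c2 y2 (g u) (g v) = moved (arc N1) w1 c1 y1 u v.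
  by rewrite -fE2 /g /= !g2K fE1.
have gl i : g (label N1 i) = label N2 i by rewrite /g /= fl1 -fl2 f2K.
have H1 := network_simplex N1; have H2 := network_simplex N2.
have md1 := moved_degree H1 wr1 rr1 wc1 nc1 xy1 ny1 yw1 yc1.
have md2 := moved_degree H2 wr2 rr2 wc2 nc2 xy2 ny2 yw2 yc2.
have M2 := moved_simplex H2 wr2 rr2 wc2 nc2 xy2 nx2 ny2 yw2 yc2.
have gd v : degree (arc N2) (g v) = degree (arc N1) v.
  by rewrite -md1 -md2; exact: degree_iso gb gE v.
have gy : g y1 = y2.
  have rm2 v : is_retic (moved (arc N2) w2 c2 y2) v = is_retic (arc N2) v.
    by rewrite /is_retic md2.
  apply: (nonretic_child_unique M2 (v := w2) (r := r2)).
  - by rewrite (moved_retic_arc H2 wr2 rr2 nc2 ny2).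
  - by rewrite rm2.
  - by have := moved_below wc1 yw1; rewrite -gE gw.
  - by rewrite rm2 /is_retic gd.
  - exact: (moved_below wc2 yw2).
  - by rewrite rm2.
have gE' u v : arc N2 (g u) (g v) = arc N1 u v.
  rewrite (movedK H2 wc2 yw2 yc2) (movedK H1 wc1 yw1 yc1) -gE; congr moved.
  rewrite /cycle3 -!gw -!gc -!gy !(inj_eq (bij_inj gb)).
  by case: ifP => // _; case: ifP => // _; case: ifP.
have [e he] := rigid_iso rN1 rN2 gb gE' gl.
by subst N2; rewrite /= in he; rewrite -gw -gy !he.
Qed.

Lemma card_pred_pair (A B : finType) (P : A -> B -> bool) :
  #|[pred z : A * B | P z.1 z.2]| = \sum_a #|[pred b | P a b]|.
Proof.
rewrite -sum1_card; under [RHS]eq_bigr do rewrite -sum1_card.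
by rewrite pair_big_dep.
Qed.

(** For each bad [w], any of the [n - 1] or more tree vertices outside [w :: c :: p] can be taken as
    [y], and that list has at most [L + 2] entries. On the other side there are at most [4 * n]
    choices of [w] and, given [w], at most [4 ^ L.+2] of [c]. *)
Lemma sum_bad n L : \sum_(N in network_reps n)
    #|[pred w | `[< bad (arc N) L w >]]| * (n - (L + 3)) <=
  #|network_reps n| * (4 * n * 4 ^ L.+2).
Proof.
pose A (N : network n) : finType := (vertex N * vertex N)%type.
pose PA N : pred (A N) := [pred wy | `[< regraft_site L wy.1 wy.2 >]].
pose PB N : pred (A N) := [pred wc | wc.2 \in fball (arc N) L.+2 wc.1].
have lo N : #|[pred w | `[< bad (arc N) L w >]]| * (n - (L + 3)) <= #|PA N|.
  have HN := network_simplex N; set E := arc N in HN *.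
  rewrite /PA (card_pred_pair (fun w y => `[< regraft_site L w y >])).
  rewrite -sum_nat_const [leqRHS](bigID [pred w | `[< bad E L w >]]) /=.
  apply: leq_trans (leq_addr _ _); apply: leq_sum => w bw.
  have [tw [r [p [[wr rr pp wp sp] hl]]]] : bad E L w by apply/asboolP; move: bw; rewrite inE.
  have [c wc hc] := tree_child HN (tree_nleaf tw).
  have nc := tree_or_leaf_nretic hc.
  have lc : E (last r p) w \/ last r p = c.
    case: hl => [|/andP[wl nl]]; first by left.
    by right; apply: (nonretic_child_unique HN wr rr).
  pose F := [pred y | y \in w :: c :: p].
  apply: (@leq_trans #|[predD is_tree E & F]|).
    have := cardID F (is_tree E); have := leq_tree_count HN.
    have : #|[predI is_tree E & F]| <= L + 2.
      apply: leq_trans (_ : #|F| <= _).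
        by apply/subset_leq_card/fintype.subsetP => y; rewrite !inE => /andP[_ ->].
      apply: leq_trans (card_size (w :: c :: p)) _ => /=; by rewrite addn2 !ltnS.
    rewrite -[#|predI _ _|]/#|[predI is_tree E & F]|.
    move: #|[predI is_tree E & F]| #|[predD is_tree E & F]| #|is_tree E| => i j k.
    clear; lia.
  apply/subset_leq_card/fintype.subsetP => y; rewrite !inE !negb_or.
  move=> /andP[/and3P[yw yc yp] ty]; rewrite /regraft_site -/E; have {}ty : is_tree E y := ty.
  have /in_exists[x xy] : 0 < (degree E y).1 by rewrite (eqP ty).
  exists r, c, x, p; split => //; split => //; last by exact: (tree_nretic ty).
  by case/orP: (tree_parent HN ty xy) => [/root_nretic|/tree_nretic].
have hi N : #|PB N| <= 4 * n * 4 ^ L.+2.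
  have HN := network_simplex N.
  rewrite /PB (card_pred_pair (fun w c => c \in fball (arc N) L.+2 w)).
  apply: (@leq_trans (\sum_(w : vertex N) 4 ^ L.+2)).
    apply: leq_sum => w _; apply: leq_trans (card_fball HN L.+2 w).
    by apply/subset_leq_card/fintype.subsetP => c; rewrite !inE.
  by rewrite sum_nat_const leq_mul2r (card_simplex_tree_child HN) orbT.
apply: (@leq_trans (\sum_(N in network_reps n) #|PA N|)).
  by apply: leq_sum => N _; exact: lo.
apply: (@leq_trans (\sum_(N in network_reps n) #|PB N|)).
  apply: (@leq_sum_card_fibre _ _ A A PA PB (fun N a N' b => regraft (N := N) a (N' := N') b)).
    move=> N [w y] rN /asboolP /regraft_exists[N' [wc [rN' h1 h2]]].
    by exists N', wc.
  by move=> N1 a1 N2 a2 N' b r1 r2; exact: regraft_inj.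
rewrite -sum_nat_const; exact: leq_sum.
Qed.

(** * Tree leaves *)

(* The tree leaf [l] with parent [z] is hung below a new reticulation [inr true] whose
   parents are [b] and a new tree vertex [inr false]; the latter takes the place of [l]
   below [z] and receives the child [c] of [b]. *)
Section Hybrid.
Variables (n : nat) (V : finType) (E : rel V) (lab : 'I_n -> V) (l z b c : V).
Hypotheses (H : simplex_tree_child E lab) (ll : is_leaf E l) (zl : E z l)
  (nz : ~~ is_retic E z) (bb : branching E b) (bc : E b c) (lc : l != c).

Definition hybrid : rel (V + bool)%type := fun u v =>
  match u, v with
  | inl u, inl v => [&& E u v, ~~ ((u == z) && (v == l)) & ~~ ((u == b) && (v == c))]
  | inl u, inr false => u == z
  | inl u, inr true => u == b
  | inr false, inl v => v == c
  | inr true, inl v => v == l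
  | inr false, inr true => true
  | _, _ => false
  end.

Let tb : is_tree E b. Proof. by case/andP: bb. Qed.

Let nbr v : E b v -> ~~ is_retic E v.
Proof.
move=> bv; case/andP: bb => _; apply: contra => rv.
by apply/existsP; exists v; rewrite bv.
Qed.

Let nc : ~~ is_retic E c. Proof. exact: nbr. Qed.

Lemma hybrid_degree_inl v : degree hybrid (inl v) = degree E v.
Proof.
rewrite /degree; congr pair.
  (* Among the parents of [v] only two can change: [z] above [l] becomes the new reticulation, and
     [b] above [c] the new tree vertex. The children are treated likewise below. *)
  pose f u : V + bool := if (u == z) && (v == l) then inr true else
    if (u == b) && (v == c) then inr false else inl u.
  have fi : injective f.
    move=> u u'; rewrite /f.
    by case: ifP => [/andP[/eqP-> _]|_]; [|case: ifP => [/andP[/eqP-> _]|_]];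
      (case: ifP => [/andP[/eqP-> _]|_]; [|case: ifP => [/andP[/eqP-> _]|_]]) => // -[].
  rewrite -(fintype.card_image fi); apply: eq_card => u'.
  apply/idP/fintype.imageP => [|[u]]; rewrite !inE.
    case: u' => [u|[]] /=.
    - by move=> /and3P[uv /negPf h1 /negPf h2]; exists u; rewrite ?inE // /f h1 h2.
    - by move=> /eqP vl; exists z; rewrite ?inE ?vl ?zl // /f vl !eqxx.
    - move=> /eqP vc; exists b; rewrite ?inE ?vc ?bc // /f vc !eqxx /=.
      by rewrite [c == l]eq_sym (negPf lc) andbF.
  move=> uv ->; rewrite /f; case: ifP => [/andP[_ vl]//|h1] /=.
  by case: ifP => [/andP[_ vc]//|h2] /=; rewrite uv h1 h2.
pose f u : V + bool := if (v == z) && (u == l) then inr false else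
  if (v == b) && (u == c) then inr true else inl u.
have fi : injective f.
  move=> u u'; rewrite /f.
  by case: ifP => [/andP[_ /eqP->]|_]; [|case: ifP => [/andP[_ /eqP->]|_]];
    (case: ifP => [/andP[_ /eqP->]|_]; [|case: ifP => [/andP[_ /eqP->]|_]]) => // -[].
rewrite -(fintype.card_image fi); apply: eq_card => u'.
apply/idP/fintype.imageP => [|[u]]; rewrite !inE.
  case: u' => [u|[]] /=.
  - by move=> /and3P[uv /negPf h1 /negPf h2]; exists u; rewrite ?inE // /f h1 h2.
  - move=> /eqP vb; exists c; rewrite ?inE ?vb ?bc // /f vb !eqxx.
    by rewrite [c == l]eq_sym (negPf lc) andbF.
  - by move=> /eqP vz; exists l; rewrite ?inE ?vz ?zl // /f vz !eqxx.
move=> uv ->; rewrite /f; case: ifP => [/andP[vz _]//|h1] /=.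
by case: ifP => [/andP[vb _]//|h2] /=; rewrite uv h1 h2.
Qed.

Lemma hybrid_degree_tree : degree hybrid (inr false) = (1, 2).
Proof.
rewrite /degree; congr pair.
  rewrite -[RHS](card1 (inl z : V + bool)%type); apply: eq_card => -[u|[]]; by rewrite !inE.
transitivity #|pred2 (inl c : V + bool)%type (inr true)|; last by rewrite card2.
by apply: eq_card => -[u|[]]; rewrite !inE ?orbT ?orbF.
Qed.

Lemma hybrid_degree_retic : degree hybrid (inr true) = (2, 1).
Proof.
rewrite /degree; congr pair.
  transitivity #|pred2 (inl b : V + bool)%type (inr false)|; last by rewrite card2.
  by apply: eq_card => -[u|[]]; rewrite !inE ?orbT ?orbF.
by rewrite -[RHS](card1 (inl l : V + bool)%type); apply: eq_card => -[u|[]]; rewrite !inE.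
Qed.

(** The surgery creates a directed path from [z] through the new tree vertex to [c]; the hypothesis
    keeps it from closing a directed cycle. *)
Lemma hybrid_simplex : ~~ connect E c z -> simplex_tree_child hybrid (fun i => inl (lab i)).
Proof.
move=> ncz; pose M := #|V|.+1.
have hr v : rank E v < M := max_card _.
(* Descendants of [c] are raised by [2 * M], which leaves the value [M] for the new tree vertex,
   above [z] and below [c]. *)
pose h (v : V + bool) := match v with
  | inl v => if is_leaf E v then (4 * M).+1 else if is_retic E v then 4 * M
             else if connect E c v then 2 * M + rank E v else rank E v
  | inr false => M
  | inr true => 4 * M
  end.
have zz : ~~ is_leaf E z by apply: contraL zl; exact: leaf_out.
have trl v : is_tree hybrid (inl v) = is_tree E v by rewrite /is_tree hybrid_degree_inl.
have rtl v : is_retic hybrid (inl v) = is_retic E v by rewrite /is_retic hybrid_degree_inl.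
have lfl v : is_leaf hybrid (inl v) = is_leaf E v by rewrite /is_leaf hybrid_degree_inl.
have [x0 [ro _ ho]] := stc_rooted H.
apply: (@simplex_intro _ _ _ _ h).
- move=> [u|[]] [v|[]] //=.
  + move=> /and3P[uv _ _].
    have -> : is_leaf E u = false by apply/negP => /(leaf_out v); rewrite uv.
    move: (M) (hr u) (hr v) (rank_lt H uv) => m hu hv huv.
    have [lv|nlv] := boolP (is_leaf E v).
      by move: (rank E u) hu => i hi; clear -hi; case: (is_retic E u) (connect E c u) => -[]; lia.
    have [ru|nru] := boolP (is_retic E u).
      by rewrite (retic_child H ru uv) in nlv.
    have [rv|nrv] := boolP (is_retic E v).
      by move: (rank E u) hu => i hi; clear -hi; case: (connect E c u); lia.
    have [cu|ncu] := boolP (connect E c u).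
      rewrite (connect_trans cu (connect1 uv)).
      by move: (rank E u) (rank E v) huv => i j; clear; lia.
    case: (connect E c v) => //.
    by move: (rank E u) (rank E v) huv => i j; clear; lia.
  + move=> /eqP->; rewrite (negPf (tree_nleaf tb)) (negPf (tree_nretic tb)).
    move: (M) (hr b) => m; move: (rank E b) => i; clear; case: (connect E c b); lia.
  + by move=> /eqP->; rewrite (negPf zz) (negPf nz) (negPf ncz).
  + by move=> /eqP->; rewrite ll.
  + move=> /eqP->; rewrite (negPf nc) connect0.
    by move: (rank E c) => i; rewrite /M; clear; case: (is_leaf E c); lia.
  + by move=> _; rewrite /M; clear; lia.
- exists (inl x0); first by rewrite /is_root hybrid_degree_inl.
  move=> [v|[]] vo vl.
  + rewrite trl rtl; apply: ho; first by apply: contra vo => /eqP->.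
    by apply: contra vl => /codomP[i ->]; apply/codomP; exists i.
  + by rewrite /is_retic hybrid_degree_retic orbT.
  + by rewrite /is_tree hybrid_degree_tree.
- by move=> i j [] /(stc_lab_inj H).
- by move=> i; rewrite lfl (stc_lab_leaf H).
- move=> [v|[]].
  + rewrite lfl => nv; have [vz|vz] := eqVneq v z.
      by exists (inr false); rewrite /= ?vz //= /is_tree hybrid_degree_tree.
    (* Only [b] may lose the child granted by the tree-child condition; being branching, it has a
       second child that is not a reticulation. *)
    have [u [vu hu hb]] : exists u, [/\ E v u, is_tree E u || is_leaf E u &
        ~~ ((v == b) && (u == c))].
      have [vb|vb] := eqVneq v b; last by have [u] := tree_child H nv; exists u.
      have /card_gt0P[u] : 0 < #|[predD1 [pred u | E b u] & c]|.
        have : #|[pred u | E b u]| = 2 by case: (eqP tb).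
        by rewrite (cardD1 c) inE bc add1n => -[->].
      rewrite !inE => /andP[uc bu]; exists u; rewrite vb bu (negPf uc) andbF.
      by split=> //; apply: (arc_head_nretic H bu (nbr bu)).
    by exists (inl u) => /=; rewrite ?vu ?(negPf vz) ?hb // trl lfl.
  + by move=> _; exists (inl l) => /=; rewrite ?eqxx // lfl ll orbT.
  + move=> _; exists (inl c) => /=; rewrite ?eqxx // trl lfl.
    exact: (arc_head_nretic H bc nc).
- move=> [v|[]] [u|[]] //=.
  + by rewrite rtl lfl => rv /and3P[vu _ _]; apply: (retic_child H rv vu).
  + by rewrite rtl => rv /eqP vb; rewrite vb (negPf (tree_nretic tb)) in rv.
  + by rewrite rtl => rv /eqP vz; rewrite vz (negPf nz) in rv.
  + by rewrite lfl => _ /eqP->.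
  + by rewrite /is_retic hybrid_degree_tree.
  + by rewrite /is_retic hybrid_degree_tree.
Qed.

Lemma hybrid_arc u v :
  E u v = [|| hybrid (inl u) (inl v), (u == z) && (v == l) | (u == b) && (v == c)].
Proof.
rewrite /=; case: (boolP ((u == z) && (v == l))) => [/andP[/eqP-> /eqP->]|_] /=.
  by rewrite zl orbT.
case: (boolP ((u == b) && (v == c))) => [/andP[/eqP-> /eqP->]|_] /=.
  by rewrite bc orbT.
by rewrite andbT orbF.
Qed.

(** The cycle goes from the new tree vertex to the new reticulation, up to [b], down the chain [p]
    to [z] and back. Its first chain arc survives because the chain leaves [b] through a child other
    than [c]. *)
Lemma hybrid_bad p J : path E b p -> z = last b p -> all (point E) p ->
  head l p != c -> size p <= J -> bad hybrid J.+1 (inr false).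
Proof.
move=> pp ep ap hc sp; split; first by rewrite /is_tree hybrid_degree_tree.
exists (inr true), (inl b :: map inl p).
have lst : last (inl b) (map inl p) = inl z :> (V + bool) by rewrite last_map -ep.
rewrite /= lst; split; last by left; rewrite /= eqxx.
split => //; rewrite ?size_map //.
- by rewrite /is_retic hybrid_degree_retic.
- rewrite /adj /= eqxx orbT /=.
  have nq : b \notin p.
    apply/negP => /(allP ap) /andP[_]; case/andP: bb => _ /negP; exact.
  rewrite path_map; case: p pp ap hc {ep sp lst} nq => //= x p /andP[bx xp] /andP[px pp] xc.
  rewrite inE negb_or => /andP[bx' bp].
  have nleaf y : point E y -> y != l.
    by move=> /andP[/tree_nleaf ny _]; apply: contraNneq ny => ->.
  rewrite bx (negPf xc) andbF (negPf (nleaf x px)) andbF /=.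
  elim: p x xp pp px bx' bp {bx xc} => //= y p IH x /andP[xy yp] /andP[py pp] px bx.
  rewrite inE negb_or => /andP[yb bp]; rewrite IH // andbT.
  by rewrite xy (negPf (nleaf y py)) andbF [x == b]eq_sym (negPf bx).
- by apply/negP; rewrite inE /= => /mapP[].
Qed.

End Hybrid.

Lemma split_inl (V1 V2 B : finType) (g : V1 + B -> V2 + B) : bijective g ->
  (forall b, g (inr b) = inr b) ->
  exists2 g0 : V1 -> V2, bijective g0 & forall v, g (inl v) = inl (g0 v).
Proof.
move=> [h gK hK] gB.
have hB b : h (inr b) = inr b by rewrite -gB gK.
have gV v : {u | g (inl v) = inl u}.
  case e : (g (inl v)) => [u|b]; first by exists u.
  by have := gK (inl v); rewrite e hB.
have hV v : {u | h (inl v) = inl u}.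
  case e : (h (inl v)) => [u|b]; first by exists u.
  by have := hK (inl v); rewrite e gB.
exists (fun v => sval (gV v)) => [|v]; last by case: (gV v).
exists (fun v => sval (hV v)) => v.
  by case: (gV v) => u /= e; case: (hV u) => x /=; rewrite -e gK => -[].
by case: (hV v) => u /= e; case: (gV u) => x /=; rewrite -e hK => -[].
Qed.

(** * Chains of points above tree leaves *)

Section Chains.
Variables (n : nat) (V : finType) (E : rel V) (lab : 'I_n -> V).
Hypothesis H : simplex_tree_child E lab.

Definition hangs b p l := [/\ path E b (rcons p l), all (point E) p & is_leaf E l].

Definition near J l := exists b p, [/\ hangs b p l, branching E b & size p <= J].

Lemma point_tree v : point E v -> is_tree E v. Proof. by case/andP. Qed.

Lemma branching_npoint v : branching E v -> ~~ point E v.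
Proof. by move=> /andP[tv h]; rewrite /point tv. Qed.

Lemma branching_child v u : branching E v -> E v u -> ~~ is_retic E u.
Proof.
move=> /andP[_ /negP h] vu; apply/negP => ru; apply: h.
by apply/existsP; exists u; rewrite vu.
Qed.

Lemma path_pred x p v : path E x p -> v \in p -> exists2 q, q \in x :: p & E q v.
Proof.
move=> + vp; case/splitPr: vp => p1 p2; rewrite cat_path /= => /and3P[_ h _].
by exists (last x p1) => //; rewrite -cat_cons mem_cat mem_last.
Qed.

Lemma connect_last c b p : all (point E) p -> path E b p ->
  connect E c (last b p) -> connect E c b \/ c \in p.
Proof.
elim/last_ind: p => [|p x IH]; first by left.
rewrite all_rcons rcons_path last_rcons => /andP[px ap] /andP[pp lx].
case/connectP=> q; elim/last_ind: q => [_ ->|q y _].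
  by right; rewrite mem_rcons inE eqxx.
rewrite rcons_path last_rcons => /andP[qq yl] xy; subst y.
have e := parent_unique H (tree_nretic (point_tree px)) lx yl.
have cx : connect E c (last b p) by rewrite e; apply/connectP; exists q.
case: (IH ap pp cx) => h; first by left.
by right; rewrite mem_rcons inE h orbT.
Qed.

(** This supplies the acyclicity condition of the surgery. Vertices on the chain have only one
    parent, so an ancestor [c] of its end is either an ancestor of [b], against acyclicity, or a
    later chain vertex, whose parent is a point and hence not [b]. *)
Lemma sibling_disconnected b p l c : branching E b -> all (point E) p -> path E b p ->
  E b c -> head l p != c -> ~~ connect E c (last b p).
Proof.
move=> bb ap pp bc hc; apply/negP => /(connect_last ap pp)[cb|cp].
  by have /negP := stc_acyclic H bc.
case: p ap pp hc cp => //= x p /andP[px ap] /andP[bx xp] xc.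
rewrite inE eq_sym (negPf xc) /= => cp; have [q qx qc] := path_pred xp cp.
have e := parent_unique H (branching_child bb bc) bc qc.
have : point E b by rewrite e; apply: (allP (_ : all (point E) (x :: p))); rewrite //= px.
by apply/negP/branching_npoint.
Qed.

Lemma single_child b v v' : point E b || is_root E b -> E b v -> ~~ is_retic E v ->
  E b v' -> ~~ is_retic E v' -> v = v'.
Proof.
case/orP=> [/andP[_ /existsP[r /andP[br rr]]]|rb] bv nv bv' nv'.
  exact: (nonretic_child_unique H br rr).
by apply: (out_unique _ bv bv'); rewrite (eqP rb).
Qed.

(** A point or the root has a single child that is not a reticulation, so the descent from it is
    forced. *)
Lemma hangs_unique b p p' l l' : point E b || is_root E b ->
  hangs b p l -> hangs b p' l' -> l = l'.
Proof.
elim: p b p' => [|x p IH] b p' sb [/= h1 h2 ll].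
  move: h1; rewrite andbT => bl [].
  case: p' => [|x' p'] /=; first by rewrite andbT => bl' _ ll';
    apply: (single_child sb) => //; exact: leaf_nretic.
  move=> /andP[bx' _] /andP[px' _] _; exfalso.
  have e : l = x' by apply: (single_child sb) => //;
    [exact: leaf_nretic|exact/tree_nretic/point_tree].
  by have := tree_nleaf (point_tree px'); rewrite -e ll.
move: h1 h2 => /andP[bx xp] /andP[px ap] [].
case: p' => [|x' p'] /=.
  rewrite andbT => bl' _ ll'; exfalso.
  have e : x = l' by apply: (single_child sb) => //;
    [exact/tree_nretic/point_tree|exact: leaf_nretic].
  by have := tree_nleaf (point_tree px); rewrite e ll'.
move=> /andP[bx' xp'] /andP[px' ap'] ll'.
have e : x = x' by apply: (single_child sb) => //; exact/tree_nretic/point_tree.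
by subst x'; apply: (IH x p'); rewrite ?px.
Qed.

(** The chain is extended upwards until it has [J] vertices or its upper end is no longer a
    point. *)
Lemma hangs_exists J l : tree_leaf E l -> exists b p,
  [/\ hangs b p l, is_root E b || is_tree E b, size p <= J & size p = J \/ ~~ point E b].
Proof.
move=> /andP[ll /existsP[z /andP[zl nz]]].
have tz : is_root E z || is_tree E z.
  case: (vertex_cases H z) => kz; rewrite ?kz ?orbT //; first by rewrite kz in nz.
  by rewrite (negPf (leaf_out _ kz)) in zl.
elim: J => [|J [b [p [[h1 h2 _] tb sp hb]]]].
  by exists z, [::]; split=> //; [split=> //=; rewrite zl|left].
have [pb|npb] := boolP (point E b); last first.
  by exists b, p; split=> //; [exact: leqW|right].
have {hb} sp' : size p = J by case: hb => //; rewrite pb.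
have tb' := point_tree pb.
have /in_exists[a ab] : 0 < (degree E b).1 by rewrite (eqP tb').
exists a, (b :: p); split => /=; rewrite ?sp' //; first by split; rewrite //= ?ab ?pb.
  exact: (tree_parent H tb' ab).
by left.
Qed.

Definition rooted_leaf l := exists b p, hangs b p l /\ is_root E b.

Definition far J l := exists b p, hangs b p l /\ size p = J.

Lemma leq_rooted_leaf : #|[pred l | `[< rooted_leaf l >]]| <= 1.
Proof.
apply/card_le1_eqP => l l'; rewrite !inE.
move=> [b [p [h rb]]] [b' [p' [h' rb']]].
rewrite (root_unique H rb' rb) in h'.
by apply: (hangs_unique _ h' h); rewrite rb orbT.
Qed.

(** The chains above distinct leaves are disjoint, since only one leaf hangs from a given point, and
    each has [J] distinct vertices. *)
Lemma leq_far J : #|[pred l | `[< far J l >]]| * J <= #|V|.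
Proof.
pose reach v l := `[< point E v /\ exists p, hangs v p l >].
rewrite -sum_nat_const.
apply: (@leq_trans (\sum_(l in [pred l | `[< far J l >]]) #|[pred v | reach v l]|)).
  apply: leq_sum => l; rewrite inE => -[b [p [[h1 h2 ll] <-]]].
  have up : uniq p.
    have : sorted (fun u v => rank E u < rank E v) p.
      apply: (@path_sorted _ _ b).
      move: h1; rewrite rcons_path => /andP[h1 _]; apply: sub_path h1.
      by move=> u v uv; exact: (rank_lt H uv).
    apply: sorted_uniq; first by move=> v u w; exact: ltn_trans.
    by move=> u; rewrite ltnn.
  apply: leq_trans (_ : size p <= #|[pred v in p]|) _.
    by rewrite (card_uniqP up).
  apply/subset_leq_card/fintype.subsetP => v; rewrite !inE => vp.
  split; first exact: (allP h2).
  case/splitPr: vp h1 h2 => p1 p2; rewrite rcons_cat cat_path all_cat /=.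
  by move=> /and3P[_ _ h1] /and3P[_ _ h2]; exists p2.
under eq_bigr do rewrite -sum1_card big_mkcond /=.
rewrite exchange_big -[#|V|]sum1_card; apply: leq_sum => v _.
rewrite -big_mkcondr sum1_card; apply/card_le1_eqP => l l'.
move=> /andP[_]; rewrite inE => -[pv [p h]] /andP[_].
rewrite inE => -[_ [p' h']].
by apply: (hangs_unique _ h' h); rewrite pv.
Qed.

Lemma leq_tree_leaf J :
  J * #|tree_leaf E| <= J * #|[pred l | `[< near J l >]]| + J + 4 * n.
Proof.
have h : #|tree_leaf E| <= #|[pred l | `[< near J l >]]| +
    #|[pred l | `[< rooted_leaf l >]]| + #|[pred l | `[< far J l >]]|.
  set A := [pred l | _]; set B := [pred l | _]; set C := [pred l | _].
  apply: (@leq_trans #|[predU [predU A & B] & C]|).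
    apply/subset_leq_card/fintype.subsetP => l hl; rewrite !inE -orbA.
    have [b [p [hb tb sp]]] := hangs_exists J hl.
    case=> [<-|npb]; first by apply/or3P; constructor 3; apply/asboolP; exists b, p.
    case/orP: tb => tb; apply/or3P; [constructor 2|constructor 1]; apply/asboolP.
      by exists b, p.
    exists b, p; split => //; rewrite /branching tb; apply: contra npb.
    by rewrite /point tb.
  have := cardUI [predU A & B] C; have := cardUI A B.
  by move=> <- /(canRL (addnK _)) ->; rewrite (leq_trans (leq_subr _ _)) // leq_add2r leq_addr.
have := leq_rooted_leaf; have := leq_far J.
have := card_simplex_tree_child H; move: h; clear.
move: #|tree_leaf E| #|[pred l | `[< near J l >]]| #|[pred l | `[< rooted_leaf l >]]|
  #|[pred l | `[< far J l >]]| #|V| => a b c d e; nia.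
Qed.

(** A tree vertex that is not nice is the child of the root, or branching, or the parent of a tree
    leaf with a reticulation as other child. The single vertex of the first kind is absorbed by the
    difference of one between tree leaves and branching vertices. *)
Lemma card_nnice : #|[pred v | is_tree E v && ~~ nice E v]| <= 2 * #|tree_leaf E|.
Proof.
set A := [pred v | _].
pose B := [pred v | is_tree E v & [exists b, is_root E b && E b v]].
pose C := [pred v | point E v & [exists l, E v l && is_leaf E l]].
have cB : #|B| <= 1.
  apply/card_le1_eqP => v v'; rewrite !inE.
  move=> /andP[_ /existsP[b /andP[rb bv]]] /andP[_ /existsP[b' /andP[rb' bv']]].
  rewrite (root_unique H rb' rb) in bv'.
  have d1 : (degree E b).2 = 1 by rewrite (eqP rb).
  exact: (out_unique d1 bv' bv).
have cC : #|C| <= #|tree_leaf E|.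
  apply: (@leq_card_fibre _ _ C (tree_leaf E) (fun v l => E v l && is_leaf E l)).
    move=> v /andP[pv /existsP[l /andP[vl ll]]]; exists l; last by rewrite vl.
    rewrite /tree_leaf ll; apply/existsP; exists v.
    by rewrite vl (tree_nretic (point_tree pv)).
  move=> v v' l _ _ /andP[vl ll] /andP[vl' _].
  exact: (parent_unique H (leaf_nretic ll) vl vl').
have : #|A| <= #|B| + #|branching E| + #|C|.
  apply: (@leq_trans #|[predU [predU B & branching E] & C]|).
    apply/subset_leq_card/fintype.subsetP => v; rewrite !inE => /andP[tv].
    apply: contraR; rewrite !negb_or => /andP[/andP[nB nb] nC].
    have pv : point E v by move: nb; rewrite /branching /point unfold_in tv negbK.
    have /in_exists[a av] : 0 < (degree E v).1 by rewrite (eqP tv).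
    have [c vc hc] := tree_child H (tree_nleaf tv).
    rewrite /nice tv; case/andP: (pv) => _ -> /=; rewrite andbT; apply/andP; split; apply/existsP.
      exists a; rewrite av; case/orP: (tree_parent H tv av) => // ra.
      by case/negP: nB; rewrite /= tv; apply/existsP; exists a; rewrite ra.
    exists c; rewrite vc; case/orP: hc => // lc.
    by case/negP: nC; rewrite /= pv; apply/existsP; exists c; rewrite vc.
  have := cardUI [predU B & branching E] C; have := cardUI B (branching E).
  by move=> <- /(canRL (addnK _)) ->; rewrite (leq_trans (leq_subr _ _)) // leq_add2r leq_addr.
rewrite (card_tree_leaf H) in cC *; move: cB cC.
move: #|A| #|B| #|C| #|branching E| => i j k m; clear; lia.
Qed.

Lemma card_near_bad R L :
  #|[pred u | is_tree E u && `[< exists v, [/\ v \in fball E R u, is_tree E v &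
      ~~ nice E v \/ bad E L v] >]]| <=
  4 ^ R * (2 * #|tree_leaf E| + #|[pred w | `[< bad E L w >]]|).
Proof.
set A := [pred u | _].
pose B := [pred v | is_tree E v && ~~ nice E v].
pose C := [pred w | `[< bad E L w >]].
have h1 : #|A| <= #|\bigcup_(v in [predU B & C]) fball E R v|.
  apply/subset_leq_card/fintype.subsetP => u; rewrite !inE.
  move=> /andP[_ /asboolP[v [vu tv hv]]]; apply/bigcupP; exists v.
    by rewrite !inE tv /=; case: hv => [->//|/asboolT ->]; rewrite orbT.
  exact: fball_sym.
apply: (leq_trans h1).
apply: (@leq_trans (\sum_(v in [predU B & C]) 4 ^ R)).
  apply: (@leq_trans (\sum_(v in [predU B & C]) #|fball E R v|)).
    elim/big_rec2: _ => [|v k S _ h]; first by rewrite cards0.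
    by rewrite cardsU; apply: leq_trans (leq_subr _ _) _; rewrite leq_add2l.
  by apply: leq_sum => v _; exact: (card_fball H).
rewrite sum_nat_const mulnC leq_mul2l; apply/orP; right.
have := cardUI B C => /(canRL (addnK _)) ->.
by rewrite (leq_trans (leq_subr _ _)) // leq_add2r card_nnice.
Qed.

End Chains.

Definition hybridize n (N : network n) (l : vertex N) (N' : network n) (w : vertex N') :=
  let E := arc N in exists z b c (f : vertex N + bool -> vertex N'),
  [/\ [/\ is_leaf E l, E z l, ~~ is_retic E z & l != c],
      [/\ branching E b, E b c & ~~ connect E c z] &
      [/\ bijective f, forall u v, arc N' (f u) (f v) = hybrid E l z b c u v,
          forall i, f (inl (label N i)) = label N' i & w = f (inr false)]].

Lemma hybridize_exists n (N : network n) J l : near (arc N) J l ->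
  exists (N' : network n) w, [/\ N' \in network_reps n, bad (arc N') J.+1 w &
    hybridize (N := N) l (N' := N') w].
Proof.
have HN := network_simplex N; set E := arc N in HN *.
move=> [b [p [[pl ap ll] bb sp]]].
have tb : is_tree E b by case/andP: bb.
move: (pl); rewrite rcons_path => /andP[pp zl]; set z := last b p in zl.
have bc1 : E b (head l p) by case: p pl {ap sp pp zl z} => [|x p] /= /andP[].
have /card_gt0P[c] : 0 < #|[predD1 [pred u | E b u] & head l p]|.
  have : #|[pred u | E b u]| = 2 by case: (eqP tb).
  by rewrite (cardD1 (head l p)) inE bc1 add1n => -[->].
rewrite !inE => /andP[cc bc].
have nz : ~~ is_retic E z.
  rewrite /z; case/lastP: p ap {pl sp pp zl z bc1 cc} => [|p x]; first by rewrite tree_nretic.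
  by rewrite last_rcons all_rcons => /andP[/point_tree/tree_nretic].
have lc : l != c.
  have [p0|pn] := eqVneq p [::]; first by rewrite p0 eq_sym in cc.
  apply/eqP => e; rewrite -e in bc.
  have zb := parent_unique HN (leaf_nretic ll) zl bc.
  have : point E b by rewrite -zb /z (allP ap) //; case: (p) pn => //= x q _; exact: mem_last.
  by apply/negP/branching_npoint.
rewrite eq_sym in cc.
have ncz : ~~ connect E c z := sibling_disconnected HN bb ap pp bc cc.
have Hc := hybrid_simplex HN ll zl nz bb bc lc ncz.
have [N' [rN' [f [fb fE fl]]]] := reps_complete Hc.
exists N', (f (inr false)); split => //; last by exists z, b, c, f; split.
apply: (bad_iso fb fE); exact: (hybrid_bad ll bb pp erefl ap cc sp).
Qed.

(** One mark suffices here: the new tree vertex determines its reticulation child, and the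
    neighbours of these two are exactly [z], [c], [b] and [l]. *)
Lemma hybridize_inj n (N1 N2 N' : network n) l1 l2 w :
  N1 \in network_reps n -> N2 \in network_reps n ->
  hybridize (N := N1) l1 (N' := N') w -> hybridize (N := N2) l2 (N' := N') w ->
  existT (fun N : network n => vertex N) N1 l1 = existT _ N2 l2.
Proof.
move=> rN1 rN2.
move=> [z1 [b1 [c1 [f1 [[ll1 zl1 nz1 lc1] [bb1 bc1 ncz1] [fb1 fE1 fl1 e1]]]]]].
move=> [z2 [b2 [c2 [f2 [[ll2 zl2 nz2 lc2] [bb2 bc2 ncz2] [fb2 fE2 fl2 e2]]]]]].
have [g1 f1K g1K] := fb1; have [g2 f2K g2K] := fb2.
have H1 := network_simplex N1; have H2 := network_simplex N2.
set E1 := arc N1 in ll1 zl1 nz1 bb1 bc1 ncz1 fE1 H1.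
set E2 := arc N2 in ll2 zl2 nz2 bb2 bc2 ncz2 fE2 H2.
set C1 := hybrid E1 l1 z1 b1 c1 in fE1; set C2 := hybrid E2 l2 z2 b2 c2 in fE2.
have HC2 : simplex_tree_child C2 (fun i => inl (label N2 i)).
  exact: (hybrid_simplex H2 ll2 zl2 nz2 bb2 bc2 lc2 ncz2).
pose g := g2 \o f1.
have gb : bijective g by apply: bij_comp => //; exists f2.
have gE u v : C2 (g u) (g v) = C1 u v by rewrite -fE2 /g /= !g2K fE1.
have gl i : g (inl (label N1 i)) = inl (label N2 i) by rewrite /g /= fl1 -fl2 f2K.
have gd v : degree C2 (g v) = degree C1 v by exact: (degree_iso gb gE v).
have dt1 : degree C1 (inr false) = (1, 2) by exact: hybrid_degree_tree.
have dr1 : degree C1 (inr true) = (2, 1) by exact: hybrid_degree_retic.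
have dt2 : degree C2 (inr false) = (1, 2) by exact: hybrid_degree_tree.
have dr2 : degree C2 (inr true) = (2, 1) by exact: hybrid_degree_retic.
have gw : g (inr false) = inr false by rewrite /g /= -e1 e2 f2K.
have gr : g (inr true) = inr true.
  apply: (retic_child_unique HC2 (v := inr false)) => //.
  - by rewrite -gw gE.
  - by rewrite /is_retic gd dr1.
  - by rewrite /is_retic dr2.
have [g0 g0b g0E] : exists2 g0, bijective g0 & forall v, g (inl v) = inl (g0 v).
  by apply: split_inl => // -[].
have gz : g0 z1 = z2.
  by have := gE (inl z1) (inr false); rewrite g0E gw /= eqxx => /eqP.
have gbb : g0 b1 = b2.
  by have := gE (inl b1) (inr true); rewrite g0E gr /= eqxx => /eqP.
have gc : g0 c1 = c2.
  by have := gE (inr false) (inl c1); rewrite g0E gw /= eqxx => /eqP.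
have gll : g0 l1 = l2.
  by have := gE (inr true) (inl l1); rewrite g0E gr /= eqxx => /eqP.
have g0A u v : E2 (g0 u) (g0 v) = E1 u v.
  rewrite (hybrid_arc zl2 bc2) (hybrid_arc zl1 bc1) -/C1 -/C2 -!g0E gE.
  by rewrite -gz -gbb -gc -gll !(inj_eq (bij_inj g0b)).
have g0l i : g0 (label N1 i) = label N2 i by have := gl i; rewrite g0E => -[].
have [e he] := rigid_iso rN1 rN2 g0b g0A g0l.
clear -gll e he; subst N2; rewrite /= in he; by rewrite -gll he.
Qed.

Lemma sum_near n J : \sum_(N in network_reps n) #|[pred l | `[< near (arc N) J l >]]| <=
  \sum_(N in network_reps n) #|[pred w | `[< bad (arc N) J.+1 w >]]|.
Proof.
pose A (N : network n) : finType := vertex N.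
apply: (@leq_sum_card_fibre _ _ A A (fun N => [pred l | `[< near (arc N) J l >]])
  (fun N => [pred w | `[< bad (arc N) J.+1 w >]])
  (fun N l N' w => hybridize (N := N) l (N' := N') w)).
  move=> N l rN /asboolP /hybridize_exists[N' [w [rN' h1 h2]]].
  by exists N', w; split => //; apply: asboolT.
by move=> N1 l1 N2 l2 N' w r1 r2; exact: hybridize_inj.
Qed.

(** * Reduced words of moves *)

(* The letters [Some true], [Some false] and [None] stand for the moves from a tree
   vertex to its tree child, to its parent, and to the other parent of its reticulation
   child. The last letter of a word is the first one to act. *)
Definition inv_letter : option bool -> option bool := omap negb.

Definition noncancel a b := b != inv_letter a.

Definition reduced (s : seq (option bool)) := sorted noncancel s.

Lemma inv_letterK : involutive inv_letter.
Proof. by case=> [[]|]. Qed.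

Section Moves.
Variables (n : nat) (V : finType) (E : rel V) (lab : 'I_n -> V).
Hypothesis H : simplex_tree_child E lab.

(** The default [v] only makes the moves total; they are evaluated at nice vertices, where the
    search succeeds. *)
Definition par v := odflt v [pick a | E a v && is_tree E a].
Definition chi v := odflt v [pick c | E v c && is_tree E c].
Definition rho v := odflt v [pick r | E v r && is_retic E r].
Definition mate v := odflt v [pick w | E w (rho v) && (w != v)].
Definition leaf_below v := odflt v [pick l | E (rho v) l].

Definition act a v :=
  match a with Some true => chi v | Some false => par v | None => mate v end.

Definition ev s v := foldr act v s.

Lemma nice_tree v : nice E v -> is_tree E v. Proof. by case/andP. Qed.

Lemma parP v : nice E v -> E (par v) v /\ is_tree E (par v).
Proof.
case/andP=> _ /and3P[/existsP[a ha] _ _]; rewrite /par.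
by case: pickP => [b /andP[]//|/(_ a)]; rewrite ha.
Qed.

Lemma chiP v : nice E v -> E v (chi v) /\ is_tree E (chi v).
Proof.
case/andP=> _ /and3P[_ /existsP[a ha] _]; rewrite /chi.
by case: pickP => [b /andP[]//|/(_ a)]; rewrite ha.
Qed.

Lemma rhoP v : nice E v -> E v (rho v) /\ is_retic E (rho v).
Proof.
case/andP=> _ /and3P[_ _ /existsP[a ha]]; rewrite /rho.
by case: pickP => [b /andP[]//|/(_ a)]; rewrite ha.
Qed.

Lemma mateP v : nice E v -> [/\ E (mate v) (rho v), mate v != v & is_tree E (mate v)].
Proof.
move=> nv; have [vr rr] := rhoP nv.
rewrite /mate; case: pickP => [w /andP[wr wv]|h] /=.
  by split=> //; exact: (retic_parent H rr wr).
have : #|[pred u | E u (rho v)]| = 2 by case: (eqP rr).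
rewrite (cardD1 v) inE vr eq_card0 // => w.
by have := h w; rewrite !inE andbC.
Qed.

Lemma leaf_belowP v : nice E v -> E (rho v) (leaf_below v) /\ is_leaf E (leaf_below v).
Proof.
move=> nv; have [vr rr] := rhoP nv.
have /out_exists[l rl] : 0 < (degree E (rho v)).2 by rewrite (eqP rr).
rewrite /leaf_below; case: pickP => [x rx|/(_ l)]; last by rewrite rl.
by split; last exact: (retic_child H rr rx).
Qed.

Lemma nice_out v x : nice E v -> E v x -> x = chi v \/ x = rho v.
Proof.
move=> nv vx; have [vr rr] := rhoP nv; have [vc tc] := chiP nv.
have [rx|nx] := boolP (is_retic E x).
  by right; exact: (retic_child_unique H vx rx vr rr).
by left; exact: (nonretic_child_unique H vr rr vx nx vc (tree_nretic tc)).
Qed.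

Lemma nice_in v x : nice E v -> E x v -> x = par v.
Proof.
move=> nv xv; have [pv _] := parP nv.
exact: (parent_unique H (tree_nretic (nice_tree nv)) xv pv).
Qed.

Lemma rho_in v x : nice E v -> E x (rho v) -> x = v \/ x = mate v.
Proof.
move=> nv xr; have [vr rr] := rhoP nv; have [mr mv _] := mateP nv.
have d2 : #|[pred u | E u (rho v)]| = 2 by case: (eqP rr).
by apply: (card2_mem d2); rewrite //= eq_sym.
Qed.

Lemma rho_out v x : nice E v -> E (rho v) x -> x = leaf_below v.
Proof.
move=> nv rx; have [_ rr] := rhoP nv; have [rl _] := leaf_belowP nv.
by apply: (out_unique _ rx rl); rewrite (eqP rr).
Qed.

Lemma leaf_below_in v x : nice E v -> E x (leaf_below v) -> x = rho v.
Proof.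
move=> nv xl; have [rl ll] := leaf_belowP nv.
exact: (parent_unique H (leaf_nretic ll) xl rl).
Qed.

Lemma par_chi v : nice E v -> nice E (chi v) -> par (chi v) = v.
Proof. by move=> nv nc; have [vc _] := chiP nv; rewrite -(nice_in nc vc). Qed.

Lemma chi_par v : nice E v -> nice E (par v) -> chi (par v) = v.
Proof.
move=> nv np; have [pv _] := parP nv; case: (nice_out np pv) => // e.
by have [_] := rhoP np; rewrite -e (negPf (tree_nretic (nice_tree nv))).
Qed.

Lemma rho_mate v : nice E v -> nice E (mate v) -> rho (mate v) = rho v.
Proof.
move=> nv nm; have [mr _ _] := mateP nv; have [_ rr] := rhoP nv.
have [mr' rr'] := rhoP nm.
exact: (retic_child_unique H mr' rr' mr rr).
Qed.

Lemma mate_mate v : nice E v -> nice E (mate v) -> mate (mate v) = v.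
Proof.
move=> nv nm; have [vr _] := rhoP nv; have [_ mv _] := mateP nv.
rewrite -(rho_mate nv nm) in vr.
by case: (rho_in nm vr) => // e; rewrite -e eqxx in mv.
Qed.

Lemma act_inv a v : nice E v -> nice E (act a v) -> act (inv_letter a) (act a v) = v.
Proof. by case: a => [[]|] /=; [exact: par_chi|exact: chi_par|exact: mate_mate]. Qed.

Lemma act_tree a v : nice E v -> is_tree E (act a v).
Proof.
by move=> nv; case: a => [[]|] /=;
  [case: (chiP nv)|case: (parP nv)|case: (mateP nv)].
Qed.

Lemma act_ball a v i u : nice E v -> v \in fball E i u -> act a v \in fball E (i + 2) u.
Proof.
move=> nv vi; have [va _] := parP nv; have [vc _] := chiP nv.
have [vr _] := rhoP nv; have [mr _ _] := mateP nv.
have st x : adj E v x -> x \in fball E i.+1 u by exact: fball_step.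
rewrite addn2; case: a => [[]|].
- by apply: (fintype.subsetP (fball_mono _ _ (leqnSn _))); apply: st; rewrite /adj vc.
- by apply: (fintype.subsetP (fball_mono _ _ (leqnSn _))); apply: st; rewrite /adj va orbT.
- apply: (@fball_step _ _ _ _ (rho v)); last by rewrite /adj mr orbT.
  by apply: st; rewrite /adj vr.
Qed.

(** * Reduced words acting in a ball of nice vertices without short cycles *)

Section Region.
Variables (R L : nat) (u : V).
Hypothesis good : forall v, v \in fball E R u -> is_tree E v -> nice E v /\ ~ bad E L v.

Definition reach i v := is_tree E v && (v \in fball E i u).

Lemma reach_nice i v : reach i v -> i <= R -> nice E v.
Proof.
move=> /andP[tv vi] iR; case: (good _ tv) => //.
exact: (fintype.subsetP (fball_mono _ _ iR)).
Qed.

Lemma reach_nbad i v : reach i v -> i <= R -> ~ bad E L v.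
Proof.
move=> /andP[tv vi] iR; case: (good _ tv) => //.
exact: (fintype.subsetP (fball_mono _ _ iR)).
Qed.

Lemma reach_act i a v : reach i v -> i <= R -> reach (i + 2) (act a v).
Proof.
move=> rv iR; have nv := reach_nice rv iR; case/andP: rv => tv vi.
by rewrite /reach act_tree //=; exact: act_ball.
Qed.

(** A letter costs two units of distance because crossing a reticulation takes two arcs. The bound
    is [R.+2] since only the source of the last move has to be nice. *)
Lemma reach_ev i s v : reach i v -> i + 2 * size s <= R.+2 -> reach (i + 2 * size s) (ev s v).
Proof.
move=> rv; elim: s => [|a s IH] /=; first by rewrite muln0 addn0.
move=> h; have {}IH := IH (leq_trans _ h).
have -> : i + 2 * (size s).+1 = i + 2 * size s + 2 by clear; lia.
by apply: reach_act; [apply: IH; clear -h; lia|clear -h; lia].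
Qed.

Lemma ev_act i a s v : reach i v -> i + 2 * (size s).+1 <= R ->
  act (inv_letter a) (ev (a :: s) v) = ev s v.
Proof.
move=> rv h; have r1 : reach (i + 2 * size s) (ev s v) by apply: reach_ev => //; clear -h; lia.
have r2 : reach (i + 2 * size (a :: s)) (ev (a :: s) v) by apply: reach_ev => //=; clear -h; lia.
by apply: act_inv; [apply: (reach_nice r1); clear -h; lia|apply: (reach_nice r2)].
Qed.

Lemma ev_cat s t v : ev (s ++ t) v = ev s (ev t v).
Proof. by rewrite /ev foldr_cat. Qed.

Lemma reduced_spine s : reduced s -> None \notin s ->
  exists b, s = nseq (size s) (Some b).
Proof.
elim: s => [|a s IH] /=; first by exists true.
case: a => [b|//]; case: s IH => [|c s] IH; first by exists b.
rewrite /= => /andP[bc rs]; rewrite inE negb_or /= => hN.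
have [b' [ec es]] := IH rs hN.
have e : b' = b by move: bc; rewrite ec; case: (b) (b') => [] [].
by exists b; rewrite ec {1}es e.
Qed.

Lemma spine_no_loop i m b v : reach i v -> i + 2 * m.+1 <= R ->
  ev (nseq m.+1 (Some b)) v != v.
Proof.
move=> rv hR.
have : if b then rank E v < rank E (ev (nseq m.+1 (Some b)) v)
       else rank E (ev (nseq m.+1 (Some b)) v) < rank E v.
  have st j x : reach j x -> j <= R -> if b then rank E x < rank E (act (Some b) x)
       else rank E (act (Some b) x) < rank E x.
    move=> rx jR; have nx := reach_nice rx jR.
    by case: b => /=; [have [h _] := chiP nx|have [h _] := parP nx]; exact: (rank_lt H h).
  elim: m hR => [|m IH] hR; first by apply: (st i) => //; clear -hR; lia.
  have := IH _; have := st (i + 2 * m.+1) (ev (nseq m.+1 (Some b)) v) _ _.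
  have r1 : reach (i + 2 * m.+1) (ev (nseq m.+1 (Some b)) v).
    by have := @reach_ev i (nseq m.+1 (Some b)) v rv; rewrite size_nseq; apply; clear -hR; lia.
  move=> /(_ r1) h1 h2; have {}h1 := h1 ltac:(clear -hR; lia); have {}h2 := h2 ltac:(clear -hR; lia).
  rewrite [nseq m.+2 _]/= [ev (_ :: _) v]/=.
  case: b h1 h2 {st r1 IH} => h1 h2; first exact: ltn_trans h2 h1.
  exact: ltn_trans h1 h2.
by case: b => h; apply: contraTneq h => ->; rewrite ltnn.
Qed.

(** Avoiding [w] need only be assumed at the tree vertices visited; the reticulations crossed differ
    from [w] by type. *)
Lemma ev_walk i s v w : reach i v -> i + 2 * size s <= R -> is_tree E w ->
  (forall s1 s2, s = s1 ++ s2 -> ev s2 v != w) ->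
  exists p, [/\ path (adj E) v p, last v p = ev s v, w \notin p & size p <= 2 * size s].
Proof.
move=> rv + tw; elim: s => [|a s IH] hR hw; first by exists [::].
have [||p [pp lp wp sp]] := IH; first by move: hR => /=; clear; lia.
  by move=> s1 s2 e; apply: (hw (a :: s1)); rewrite e.
have rx : reach (i + 2 * size s) (ev s v) by apply: reach_ev => //; move: hR => /=; clear; lia.
have nx := reach_nice rx (_ : _ <= R); have {}nx : nice E (ev s v).
  by apply: nx; move: hR => /=; clear; lia.
have hx : act a (ev s v) != w by exact: (hw [::] (a :: s)).
have [va _] := parP nx; have [vc _] := chiP nx.
have [vr rr] := rhoP nx; have [mr _ _] := mateP nx.
have rw : rho (ev s v) != w.
  by apply: contraTneq rr => ->; exact: tree_nretic.
case: a hx hw hR => [b|] hx hw hR.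
  exists (rcons p (act (Some b) (ev s v))).
  rewrite rcons_path pp lp last_rcons size_rcons mem_rcons inE negb_or eq_sym hx wp.
  split => //=; last by rewrite mulnS; clear -sp; lia.
  by rewrite /adj; case: (b) => /=; rewrite ?vc ?va ?orbT.
exists (rcons (rcons p (rho (ev s v))) (mate (ev s v))).
rewrite !rcons_path pp lp !last_rcons !size_rcons !(mem_rcons, inE) !negb_or.
rewrite /= in hx; rewrite ![w == _]eq_sym hx rw wp; split => //=; last by rewrite mulnS; clear -sp; lia.
by rewrite /adj vr mr orbT.
Qed.

Lemma no_loop_bound i m : i + m.+1 * (m.+1 + 5) <= R ->
  i + 6 * m.+1 <= R /\ i + (2 * m + 2) + m * (m + 5) <= R.
Proof. move=> h; split; apply: leq_trans h; clear; nia. Qed.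

(** A shortest nontrivial reduced loop would exhibit a bad vertex. The radius is quadratic in [m]
    because each induction step may move the base point along the loop, at a cost linear in [m]. *)
Lemma no_loop m s i v : size s <= m -> 2 * m <= L -> i + m * (m + 5) <= R ->
  reduced s -> s != [::] -> reach i v -> ev s v != v.
Proof.
elim: m s i v => [|m IH] s i v sm mL mR rs sn rv; first by case: s sm sn rs.
have [hR hR'] := no_loop_bound mR; have iR : i <= R := leq_trans (leq_addr _ _) hR.
have nv := reach_nice rv iR; have [_ mv _] := mateP nv.
apply/eqP => loop.
have single : s <> [:: None] by move=> e; rewrite e /= in loop; rewrite loop eqxx in mv.
(* If the first and last letters cancel, conjugation removes both and leaves a shorter loop based at
   [act z v]. *)
have [cs|] := boolP (cycle noncancel s); last first.
  case: s sm rs sn single loop => // a s sm rs _ single loop.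
  rewrite /= rcons_path; move: rs; rewrite /reduced /= => rs; rewrite rs /= negbK => /eqP az.
  case/lastP: s => [|s z] in sm rs single loop az *.
    by apply: single; case: a az {rs loop sm} => [[]|].
  rewrite last_rcons in az; case: s => [|b s] in sm rs single loop *.
    by move: rs; rewrite /= /noncancel az inv_letterK eqxx.
  have rz := reach_act z rv iR; rewrite /= size_rcons in sm.
  have : ev (b :: s) (act z v) != act z v.
    apply: (IH _ (i + 2)) => //=; [clear -sm; lia|clear -mL; lia|clear -hR'; lia|].
    by move: rs; rewrite rcons_path => /andP[/path_sorted].
  apply/negP; rewrite negbK; apply/eqP.
  have hs : i + 2 * (size (rcons (b :: s) z)).+1 <= R by rewrite size_rcons /=; clear -hR sm; lia.
  have := ev_act a rv hs; rewrite loop az inv_letterK => e0; by rewrite [RHS]e0 /ev foldr_rcons.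
(* Without [None] the word is a power of one letter, and the rank changes strictly monotonically
   along it. *)
have [Ns|/(reduced_spine rs)[b e]] := boolP (None \in s); last first.
  case: s => [//|a s] in e rs sm loop sn single cs *.
  have := @spine_no_loop i (size s) b v rv; rewrite -[nseq _ _]e loop eqxx => h.
  by have : false by apply: h; rewrite /= in sm; clear -hR sm; lia.
(* The loop is rebased at [v1], so that it starts by crossing the reticulation below [v1]. *)
have [s1 [s2 es]] : exists s1 s2 : seq (option bool), s = s1 ++ None :: s2.
  by case/splitPr: Ns => s1 s2; exists s1, s2.
subst s.
pose v1 := ev s2 v; rewrite size_cat /= in sm.
have r1 : reach (i + 2 * size s2) v1 by apply: reach_ev => //; clear -hR sm; lia.
have n1 : nice E v1 by apply: (reach_nice r1); clear -hR sm; lia.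
have loop1 : ev (s2 ++ s1) (mate v1) = v1.
  by rewrite ev_cat; move: loop; rewrite ev_cat /= => ->.
have cs1 : cycle noncancel (rcons (s2 ++ s1) None).
  rewrite -cat_rcons in cs.
  by rewrite rcons_cat -rot_size_cat rot_cycle.
case et : (s2 ++ s1) cs1 loop1 => [|a t].
  move=> _ _; apply: single.
  have [-> ->] : s1 = [::] /\ s2 = [::] by case: (s2) et => //; case: (s1).
  by [].
rewrite /= rcons_path => /andP[rt aN] loop1.
have st : (size t).+1 = size s1 + size s2 by rewrite addnC -size_cat et.
have rm : reach (i + 2 * size s2 + 2) (mate v1).
  by apply: (@reach_act _ None) => //; clear -hR sm; lia.
have [||p [pp lp wp sp]] := @ev_walk _ t (mate v1) v1 rm _ (nice_tree n1).
- clear -hR sm st; lia.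
(* An early return to [v1] would be a shorter reduced loop, so the walk avoids [v1] as [bad]
   requires. *)
- move=> t1 t2 e; have : ev (rcons t2 None) v1 != v1.
    apply: (IH _ (i + 2 * size s2)) => //.
    + by rewrite size_rcons; move: st; rewrite e size_cat; clear -sm; lia.
    + by clear -mL; lia.
    + by clear -hR' sm; lia.
    + move: rt; rewrite e rcons_cat => /path_sorted; rewrite /reduced.
      by move=> /(drop_sorted (size t1)); rewrite drop_size_cat.
    + by case: (t2).
  by rewrite /ev foldr_rcons.
apply: (@reach_nbad (i + 2 * size s2) v1 r1); first by clear -hR sm; lia.
split; first exact: nice_tree.
have [vr rr] := rhoP n1; have [mr m1 _] := mateP n1.
exists (rho v1), (mate v1 :: p); rewrite /= inE negb_or eq_sym m1 pp lp; split.
  split=> //=; first by rewrite /adj mr orbT.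
  by clear -sp st sm mL; lia.
have rx : reach (i + 2 * size s2 + 2 + 2 * size t) (ev t (mate v1)).
  by apply: reach_ev => //; clear -hR sm st; lia.
have nx : nice E (ev t (mate v1)) by apply: (reach_nice rx); clear -hR sm st; lia.
(* The last letter is not [None], which would cancel the initial crossing; the cycle thus closes
   through the parent or the tree child of [v1]. *)
case: a aN et loop1 {rt} => [[]|] aN et loop1; last by move: aN; rewrite last_rcons.
  have e : chi (ev t (mate v1)) = v1 := loop1.
  by left; have [h _] := chiP nx; rewrite e in h.
have e : par (ev t (mate v1)) = v1 := loop1.
have [h _] := parP nx; rewrite e in h; right; rewrite h.
exact: (tree_nretic (nice_tree nx)).
Qed.

(** Letters are shifted from one word to the other, which keeps the total length, until the equation
    becomes a loop. If the leading letters differ, the shifted word is still reduced, and induction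
    would make [a :: s] begin with a cancelling pair. *)
Lemma ev_inj m s s' : size s + size s' <= m -> 2 * m <= L -> m * (m + 5) <= R ->
  is_tree E u -> reduced s -> reduced s' -> ev s u = ev s' u -> s = s'.
Proof.
move=> + mL mR tu; have h2m : 2 * m <= R.
  by apply: leq_trans mR; clear; nia.
have ru : reach 0 u by rewrite /reach tu /= inE.
elim: s s' => [|a s IH] [|a' s'] //= sm rs rs' e.
- by have := @no_loop m (a' :: s') 0 u sm mL mR rs' isT ru; rewrite /= -e eqxx.
- by have := @no_loop m (a :: s) 0 u _ mL mR rs isT ru; rewrite /= e eqxx addn0 in sm * => /(_ sm).
have rs0 : reduced s by exact: path_sorted rs.
have b1 : 0 + 2 * (size s).+1 <= R by clear -h2m sm; lia.
have b2 : 0 + 2 * (size s').+1 <= R by clear -h2m sm; lia.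
have es := ev_act a ru b1.
have [aa|aa] := eqVneq a a'.
  subst a'; congr cons; apply: IH => //; first by clear -sm; lia.
    by exact: path_sorted rs'.
  by rewrite -es -(ev_act a ru b2) /= e.
have := IH [:: inv_letter a, a' & s']; rewrite /= => h.
have {h} h : s = [:: inv_letter a, a' & s'].
  apply: h => //; first by clear -sm; lia.
    by rewrite /reduced /= in rs' *; rewrite rs' /noncancel inv_letterK eq_sym aa.
  by rewrite -es /= e.
by move: rs; rewrite h /reduced /= /noncancel eqxx.
Qed.

End Region.
End Moves.

(** * The decorated chain as a universal cover *)

Lemma rgraph_iso_sym G G' : rgraph_iso G G' -> rgraph_iso G' G.
Proof.
move=> [f [[g fK gK] fr fm fa]]; exists g; split.
- by exists f.
- by rewrite -fr fK.
- by move=> v; rewrite -fm gK.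
- by move=> u v; rewrite -fa !gK.
Qed.

Lemma rgraph_iso_trans G G' G'' : rgraph_iso G G' -> rgraph_iso G' G'' -> rgraph_iso G G''.
Proof.
move=> [f [fb fr fm fa]] [g [gb gr gm ga]]; exists (g \o f); split.
- exact: bij_comp.
- by rewrite /= fr gr.
- by move=> v /=; rewrite gm fm.
- by move=> u v /=; rewrite ga fa.
Qed.

Definition spine_word (k : int) : seq (option bool) :=
  match k with Posz m => nseq m (Some true) | Negz m => nseq m.+1 (Some false) end.

(** The moves from [p_0] to [x], read from the right: reach the vertex whose decoration created the
    spine, cross its reticulation, then walk along the spine. *)
Fixpoint dec_word (x : decorated) : seq (option bool) :=
  match x with
  | Chain k => spine_word k
  | Side x k => spine_word (val k) ++ None :: dec_word x
  end.

Lemma spine_word_inj (k k' : int) s s' :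
  (forall b s0, s <> Some b :: s0) -> (forall b s0, s' <> Some b :: s0) ->
  spine_word k ++ s = spine_word k' ++ s' -> k = k' /\ s = s'.
Proof.
move=> hs hs'.
have aux b m m' : nseq m (Some b) ++ s = nseq m' (Some b) ++ s' -> m = m' /\ s = s'.
  elim: m m' => [|m IH] [|m'] //= e; first by case: (hs _ _ e).
    by case: (hs' _ _ (esym e)).
  by case: e => /IH[-> ->].
case: k k' => m [] m' //=.
- by move=> /aux[-> ->].
- by case: m => [|m] //= /hs.
- by case: m' => [|m'] //= /esym/hs'.
- by case=> /aux[-> ->].
Qed.

Lemma dec_word_inj : injective dec_word.
Proof.
have nN (s : seq (option bool)) b s0 : None :: s <> Some b :: s0 by [].
have n0 b (s0 : seq (option bool)) : [::] <> Some b :: s0 by [].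
elim=> [k|x IH [k hk]] [k'|x' [k' hk']] /=.
- rewrite -[spine_word k]cats0 -[spine_word k']cats0.
  by case/(spine_word_inj (@n0) (@n0)) => ->.
- rewrite -[spine_word k]cats0.
  by case/(spine_word_inj (@n0) (@nN _)).
- rewrite -[spine_word k']cats0.
  by case/(spine_word_inj (@nN _) (@n0)).
- case/(spine_word_inj (@nN _) (@nN _)) => ek [/IH ->]; subst k'.
  by congr Side; apply: val_inj.
Qed.

(** This is where the nonzero index in [Side] matters: the words starting with [None] are left for
    the vertices [W x]. *)
Lemma dec_word_Nhead x s : dec_word x <> None :: s.
Proof. by case: x => [[[|m]|m]|x [[[|m]|m] hk]]. Qed.

Lemma reduced_spine_cat k s : reduced s -> (forall b s0, s <> Some b :: s0) ->
  reduced (spine_word k ++ s).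
Proof.
move=> rs hs.
have aux b m : reduced (nseq m (Some b) ++ s).
  elim: m => [|m] //=; case: m => [|m] /= IH; last by rewrite /reduced /= in IH *; rewrite IH; case: b {IH}.
  by case: s rs hs {IH} => //= -[c|] s; [case: b|move=> rs _] => // _ /(_ c s).
by case: k => m; exact: aux.
Qed.

Lemma reduced_dec_word x : reduced (dec_word x) /\ reduced (None :: dec_word x).
Proof.
have r1 : reduced (dec_word x).
  elim: x => [k|x IH k] /=.
    by rewrite -[spine_word k]cats0; apply: reduced_spine_cat.
  apply: reduced_spine_cat => //; move: IH (@dec_word_Nhead x); rewrite /reduced /=.
  by case: (dec_word x) => //= -[b|] s -> // /(_ s).
split=> //; move: r1 (@dec_word_Nhead x); rewrite /reduced /=.
by case: (dec_word x) => //= -[b|] s -> // /(_ s).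
Qed.

Lemma spine_wordS (k : int) : spine_word (k + 1)%R = Some true :: spine_word k \/
  spine_word k = Some false :: spine_word (k + 1)%R.
Proof.
case: k => m; first by left; rewrite -PoszD addn1.
right; case: m => [//|m].
have -> : (Negz m.+1 + 1 = Negz m)%R by lia.
by [].
Qed.

Definition is_spine (v : chain_vertex) : bool :=
  match v with Dec _ | W _ => true | _ => false end.

(** A reticulation and its leaf borrow the word of the decorated vertex above them, so that an arc
    changes the length by at most one and distances bound lengths. *)
Definition word (v : chain_vertex) : seq (option bool) :=
  match v with Dec x | Rho x | Ell x => dec_word x | W x => None :: dec_word x end.

Lemma word_side x k : word (side_spine x k) = spine_word k ++ None :: dec_word x.
Proof.
rewrite /side_spine; case: insubP => [j hj <-//|]; by rewrite negbK => /eqP->.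
Qed.

Lemma is_spine_side x k : is_spine (side_spine x k).
Proof. by rewrite /side_spine; case: insubP. Qed.

Definition next_word s s' := s' = Some true :: s \/ s = Some false :: s'.

Lemma spine_arc_word v v' : is_spine v -> is_spine v' -> chain_arc v v' ->
  next_word (word v) (word v').
Proof.
move=> + + h; case: h => //= [k|x k] _ _; first exact: spine_wordS.
rewrite !word_side; case: (spine_wordS k) => ->; [left|right]; by [].
Qed.

Lemma spine_succ v : is_spine v -> exists2 v', is_spine v' & chain_arc v v'.
Proof.
have sd x k : exists2 v', is_spine v' & chain_arc (side_spine x k) v'.
  by exists (side_spine x (k + 1)%R); [exact: is_spine_side|exact: arc_side].
case: v => // [[k|x k]|x] _.
- by exists (Dec (Chain (k + 1)%R)) => //; exact: arc_main.
- by have := sd x (val k); rewrite /side_spine valK.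
- by have := sd x 0%R; rewrite {1}/side_spine insubF.
Qed.

Lemma spine_pred v : is_spine v -> exists2 v', is_spine v' & chain_arc v' v.
Proof.
have sd x k : exists2 v', is_spine v' & chain_arc v' (side_spine x k).
  exists (side_spine x (k - 1)%R); first exact: is_spine_side.
  by rewrite -{2}(subrK 1%R k); exact: arc_side.
case: v => // [[k|x k]|x] _.
- exists (Dec (Chain (k - 1)%R)) => //; rewrite -{2}(subrK 1%R k); exact: arc_main.
- by have := sd x (val k); rewrite {1}/side_spine valK.
- by have := sd x 0%R; rewrite {1}/side_spine insubF.
Qed.

Lemma size_word_arc v v' : chain_arc v v' ->
  size (word v) <= (size (word v')).+1 /\ size (word v') <= (size (word v)).+1.
Proof.
have nw s s' : next_word s s' -> size s <= (size s').+1 /\ size s' <= (size s).+1.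
  by case=> -> /=; split=> //; rewrite ltnW.
case=> [k|x k|x|x|x]; try by split => //=; rewrite ltnW.
  by apply: nw; apply: spine_arc_word => //; exact: arc_main.
by apply: nw; apply: spine_arc_word; rewrite ?is_spine_side //; exact: arc_side.
Qed.

Lemma size_word_ball s v : @gball s decorated_chain v -> size (word v) <= s.
Proof.
elim: s v => [|s IH] v /=; first by move=> ->.
case=> [/IH/leqW//|[u /IH hu [uv|vu]]].
  by have [_ h] := size_word_arc uv; exact: leq_trans h _.
by have [h _] := size_word_arc vu; exact: leq_trans h _.
Qed.

Lemma inj_surj_bij (A B : Type) (f : A -> B) :
  injective f -> (forall b, exists a, f a = b) -> bijective f.
Proof.
move=> fi fs; exists (fun b => sval (cid (fs b))) => [a|b]; last by case: cid.
by apply: fi; case: cid.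
Qed.

(** * The covering map near a typical vertex *)

Section LocalIso.
Variables (n : nat) (N : network n) (k : nat) (u : vertex N).
Let E := arc N.
(** Injectivity compares two words of length at most [k], so [ev_inj] is applied with [m = 2 * k]:
    this gives the radius [m * (m + 5)] and the cycle bound [2 * m]. *)
Let R := 2 * k * (2 * k + 5).
Hypothesis tu : is_tree E u.
Hypothesis good : forall v, v \in fball E R u -> is_tree E v ->
  nice E v /\ ~ bad E (4 * k) v.

Let H := network_simplex N.

Definition unfolding (v : chain_vertex) : vertex N :=
  match v with
  | Dec _ | W _ => ev E (word v) u
  | Rho x => rho E (ev E (dec_word x) u)
  | Ell x => leaf_below E (ev E (dec_word x) u)
  end.

Lemma unfolding_spine v : is_spine v -> unfolding v = ev E (word v) u.
Proof. by case: v. Qed.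

Lemma nice_ev s : size s <= k -> nice E (ev E s u).
Proof.
move=> sk; have ru : reach E u 0 u by rewrite /reach tu /= inE.
have hR : 2 * size s <= R by rewrite /R; clear -sk; nia.
have rs : reach E u (0 + 2 * size s) (ev E s u).
  apply: (reach_ev H good ru); clear -hR; lia.
by apply: (reach_nice good rs); clear -hR; lia.
Qed.

Lemma ev_next s s' : next_word s s' -> size s <= k -> size s' <= k ->
  ev E s' u = chi E (ev E s u) /\ ev E s u = par E (ev E s' u).
Proof.
move=> h /nice_ev ns /nice_ev ns'; case: h => e; subst => /=.
  by split=> //; rewrite (par_chi H).
by split=> //; rewrite (chi_par H).
Qed.

Lemma unfolding_arc v v' : chain_arc v v' -> size (word v) <= k -> size (word v') <= k ->
  E (unfolding v) (unfolding v').
Proof.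
have sp a b : is_spine a -> is_spine b -> chain_arc a b ->
    size (word a) <= k -> size (word b) <= k -> E (unfolding a) (unfolding b).
  move=> sa sb ab ka kb; rewrite !unfolding_spine //.
  have [-> _] := ev_next (spine_arc_word sa sb ab) ka kb.
  by have [] := chiP (nice_ev ka).
case=> [i|x i|x|x|x] hv hv'.
- by apply: sp => //; exact: arc_main.
- by apply: sp; rewrite ?is_spine_side //; exact: arc_side.
- by have [] := rhoP (nice_ev hv).
- by have [] := mateP H (nice_ev hv').
- by have [] := leaf_belowP H (nice_ev hv).
Qed.

Lemma out_lift v z : size (word v) < k -> E (unfolding v) z ->
  exists2 v', chain_arc v v' & unfolding v' = z.
Proof.
move=> hv.
have sp : is_spine v -> E (unfolding v) z -> z <> rho E (unfolding v) ->
    exists2 v', chain_arc v v' & unfolding v' = z.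
  move=> sv; rewrite unfolding_spine // => vz zr.
  case: (nice_out H (nice_ev (ltnW hv)) vz) => // ->.
  have [v' sv' vv'] := spine_succ sv; exists v' => //.
  have [_ hv'] := size_word_arc vv'.
  have [e _] := ev_next (spine_arc_word sv sv' vv') (ltnW hv) (leq_trans hv' hv).
  by rewrite unfolding_spine.
case: v hv sp => [x|x|x|x] /= hv sp vz.
- have [->|/eqP zr] := eqVneq z (rho E (unfolding (Dec x))); last exact: sp.
  by exists (Rho x) => //; exact: arc_decorated_rho.
- have [->|/eqP zr] := eqVneq z (rho E (unfolding (W x))); last exact: sp.
  exists (Rho x); first exact: arc_w_rho.
  have n1 : nice E (ev E (dec_word x) u) by apply: nice_ev; do 2!apply: ltnW.
  have n2 : nice E (mate E (ev E (dec_word x) u)) := @nice_ev (None :: _) (ltnW hv).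
  by rewrite /= (rho_mate H n1 n2).
- exists (Ell x); first exact: arc_rho_leaf.
  by rewrite /= (rho_out H (nice_ev (ltnW hv)) vz).
- have [_ ll] := leaf_belowP H (nice_ev (ltnW hv)).
  by case/negP: (leaf_out z ll).
Qed.

Lemma in_lift v z : size (word v) < k -> E z (unfolding v) ->
  exists2 v', chain_arc v' v & unfolding v' = z.
Proof.
move=> hv.
have sp : is_spine v -> E z (unfolding v) ->
    exists2 v', chain_arc v' v & unfolding v' = z.
  move=> sv; rewrite unfolding_spine // => /(nice_in H (nice_ev (ltnW hv))) ->.
  have [v' sv' vv'] := spine_pred sv; exists v' => //.
  have [hv' _] := size_word_arc vv'.
  have [_ e] := ev_next (spine_arc_word sv' sv vv') (leq_trans hv' hv) (ltnW hv).
  by rewrite unfolding_spine.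
case: v hv sp => [x|x|x|x] hv sp vz; try exact: sp.
- case: (rho_in H (nice_ev (ltnW hv)) vz) => ->.
    by exists (Dec x) => //; exact: arc_decorated_rho.
  by exists (W x) => //; exact: arc_w_rho.
- exists (Rho x); first exact: arc_rho_leaf.
  by rewrite (leaf_below_in H (nice_ev (ltnW hv)) vz).
Qed.

Lemma unfolding_mark v : size (word v) <= k -> net_mark (unfolding v) = chain_mark v.
Proof.
rewrite /net_mark -/E /is_root /is_tree /is_retic; case: v => [x|x|x|x] hv.
- by rewrite (eqP (nice_tree (nice_ev hv))).
- by rewrite (eqP (nice_tree (nice_ev hv))).
- by have [_ /eqP->] := rhoP (nice_ev hv).
- by have [_ /eqP->] := leaf_belowP H (nice_ev hv).
Qed.

Lemma ev_word_inj s s' : size s <= k -> size s' <= k -> reduced s -> reduced s' ->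
  ev E s u = ev E s' u -> s = s'.
Proof.
move=> sk sk'; apply: (@ev_inj _ _ _ _ H R (4 * k) u good (2 * k)) => //.
- by clear -sk sk'; lia.
- by clear; lia.
Qed.

(** Types are preserved, so only vertices of the same type, or [Dec] and [W], can collide. If two
    reticulations coincide, their decorated vertices are equal or mates; a mate would have a word
    starting with [None]. Strict bounds leave room for that letter. *)
Lemma unfolding_inj v v' : size (word v) < k -> size (word v') < k ->
  unfolding v = unfolding v' -> v = v'.
Proof.
move=> hv hv' e.
have em : chain_mark v = chain_mark v'.
  by rewrite -!unfolding_mark ?e // ltnW.
have rI x x' : size (dec_word x) < k -> size (dec_word x') < k ->
    rho E (ev E (dec_word x) u) = rho E (ev E (dec_word x') u) -> x = x'.
  move=> hx hx' er; have [r' _] := rhoP (nice_ev (ltnW hx')); rewrite -er in r'.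
  have [rx Nrx] := reduced_dec_word x; have [rx' _] := reduced_dec_word x'.
  case: (rho_in H (nice_ev (ltnW hx)) r') => h.
    by apply: dec_word_inj; apply: ev_word_inj => //; exact: ltnW.
  have := @ev_word_inj (dec_word x') (None :: dec_word x) (ltnW hx') hx rx' Nrx h.
  by move/dec_word_Nhead.
case: v v' hv hv' em e => [x|x|x|x] [x'|x'|x'|x'] //= hv hv' _ e.
- have [rx _] := reduced_dec_word x; have [rx' _] := reduced_dec_word x'.
  by congr Dec; apply: dec_word_inj; apply: ev_word_inj => //; exact: ltnW.
- have [rx _] := reduced_dec_word x; have [_ rx'] := reduced_dec_word x'.
  by have /dec_word_Nhead := @ev_word_inj _ (None :: _) (ltnW hv) (ltnW hv') rx rx' e.
- have [_ rx] := reduced_dec_word x; have [rx' _] := reduced_dec_word x'.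
  by have /esym/dec_word_Nhead := @ev_word_inj (None :: _) _ (ltnW hv) (ltnW hv') rx rx' e.
- have [_ rx] := reduced_dec_word x; have [_ rx'] := reduced_dec_word x'.
  have := @ev_word_inj (None :: _) (None :: _) (ltnW hv) (ltnW hv') rx rx' e.
  by case=> /dec_word_inj ->.
- by congr Rho; apply: rI.
- congr Ell; apply: rI => //.
  have [rl _] := leaf_belowP H (nice_ev (ltnW hv)).
  by rewrite e in rl; rewrite (leaf_below_in H (nice_ev (ltnW hv')) rl).
Qed.

Lemma unfolding_ball s v : s <= k -> @gball s decorated_chain v ->
  @gball s (rooted_at u) (unfolding v).
Proof.
elim: s v => [|s IH] v sk /=; first by move=> ->.
case=> [/(IH _ (ltnW sk)) ?|[w hw vw]]; first by left.
right; exists (unfolding w); first exact: (IH _ (ltnW sk)).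
have sw := leq_trans (size_word_ball hw) (ltnW sk).
have sv : size (word v) <= k.
  apply: leq_trans sk; apply: (@size_word_ball s.+1) => /=; right.
  by exists w.
by case: vw => [h|h]; [left|right]; exact: unfolding_arc.
Qed.

Lemma unfolding_surj s z : s <= k -> @gball s (rooted_at u) z ->
  exists2 v, @gball s decorated_chain v & unfolding v = z.
Proof.
elim: s z => [|s IH] z sk /=; first by move=> ->; exists (Dec (Chain 0)).
case=> [/(IH _ (ltnW sk))[v hv <-]|[w /(IH _ (ltnW sk))[v hv <-] vw]].
  by exists v => //; left.
have sv : size (word v) < k := leq_ltn_trans (size_word_ball hv) sk.
case: vw => /= h; first have [v' vv' e] := out_lift sv h.
  by exists v' => //; right; exists v => //; left.
have [v' vv' e] := in_lift sv h.
by exists v' => //; right; exists v => //; right.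
Qed.

Lemma neighbourhood_iso r : r.+2 <= k ->
  rgraph_iso (neighbourhood r (rooted_at u)) (neighbourhood r decorated_chain).
Proof.
move=> rk; apply: rgraph_iso_sym.
have rk1 : r < k by apply: leq_trans rk; exact: leqnSn.
have vB (v : gvert (neighbourhood r decorated_chain)) : @gball r decorated_chain (val v).
  exact: (set_mem (valP v)).
have sB (v : gvert (neighbourhood r decorated_chain)) : size (word (val v)) < k.
  exact: leq_ltn_trans (size_word_ball (vB v)) rk1.
pose f (v : gvert (neighbourhood r decorated_chain)) : gvert (neighbourhood r (rooted_at u)) :=
  SigSub (mem_set (unfolding_ball (ltnW rk1) (vB v))).
exists f; split.
- apply: inj_surj_bij => [v v' /(congr1 val)|z].
    by move=> /= /(unfolding_inj (sB v) (sB v')) /val_inj.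
  have [v hv e] := unfolding_surj (ltnW rk1) (set_mem (valP z)).
  by exists (SigSub (mem_set hv)); apply: val_inj.
- exact: val_inj.
- by move=> v; apply: unfolding_mark; exact: (ltnW (sB v)).
(* An arc between images lifts to one leaving [v], whose head may lie at distance [r + 1];
   identifying that head with [v'] by injectivity requires [r.+2 <= k]. *)
- move=> v v'; split => /= h; last exact: (unfolding_arc h (ltnW (sB v)) (ltnW (sB v'))).
  have [v'' vv'' e] := out_lift (sB v) h.
  have [_ s''] := size_word_arc vv''.
  suff -> : val v' = v'' by [].
  apply: unfolding_inj => //.
  apply: leq_ltn_trans s'' _; apply: leq_trans rk; rewrite !ltnS.
  exact: (size_word_ball (vB v)).
Qed.

End LocalIso.

(** * The local limit *)

(* The vertices [1, ..., 2 * n - 1] form a binary heap below the root [0]. *)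
Section Heap.
Variables (n : nat) (n0 : 0 < n).

Definition heap_arc : rel 'I_(2 * n) := fun u v => (0 < v) && (u == v %/ 2 :> nat).

Let lab_lt (i : 'I_n) : n + i < 2 * n.
Proof. by rewrite mul2n -addnn ltn_add2l. Qed.

Definition heap_label (i : 'I_n) : 'I_(2 * n) := Ordinal (lab_lt i).

Lemma heap_degree v : degree heap_arc v =
  if val v == 0 then (0, 1) else if v < n then (1, 2) else (1, 0).
Proof.
have lt2 (m : nat) : m < n -> (2 * m).+1 < 2 * n by clear; lia.
rewrite /degree; have -> : #|[pred u | heap_arc u v]| = (val v != 0).
  case: eqVneq => [v0|v0].
    by apply: eq_card0 => u; rewrite inE /heap_arc v0.
  have hv : v %/ 2 < 2 * n by apply: leq_ltn_trans (leq_div _ _) (ltn_ord v).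
  rewrite -[RHS](card1 (Ordinal hv)); apply: eq_card => u.
  by rewrite !inE /heap_arc lt0n v0 -val_eqE.
have -> : #|[pred u | heap_arc v u]| = if val v == 0 then 1 else if v < n then 2 else 0.
  case: eqVneq => [v0|v0].
    have h1 : 1 < 2 * n by rewrite -[1]/((2 * 0).+1) lt2.
    rewrite -[RHS](card1 (Ordinal h1)); apply: eq_card => u.
    rewrite !inE /heap_arc v0 -val_eqE /=; move: (val u); clear; lia.
  case: ltnP => vn; last first.
    apply: eq_card0 => u; rewrite inE /heap_arc; apply/negP => /andP[_ /eqP e].
    have := ltn_ord u; clear -e vn; lia.
  have h1 := lt2 _ vn; have h0 := ltnW h1.
  transitivity #|pred2 (Ordinal h0) (Ordinal h1)|.
    apply: eq_card => u; rewrite !inE /heap_arc -!val_eqE /=.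
    move: v0; rewrite -[val v]/(nat_of_ord v).
    by move: (nat_of_ord u) (nat_of_ord v); clear => x y; lia.
  by rewrite card2 -val_eqE /= neq_ltn ltnSn.
by case: eqVneq => //; case: ltnP.
Qed.

Lemma heap_simplex : simplex_tree_child heap_arc heap_label.
Proof.
have nr v : ~~ is_retic heap_arc v.
  by rewrite /is_retic heap_degree; case: ifP => //; case: ifP.
have tl v : val v != 0 -> is_tree heap_arc v || is_leaf heap_arc v.
  by rewrite /is_tree /is_leaf heap_degree => /negPf->; case: ifP.
have h0 : 0 < 2 * n by rewrite muln_gt0.
apply: (@simplex_intro _ _ _ _ val).
- by move=> u v /andP[v0 /eqP e]; rewrite [val u]e ltn_Pdiv.
- exists (Ordinal h0); first by rewrite /is_root heap_degree.
  move=> v; rewrite -val_eqE /= => v0 vl; rewrite /is_tree heap_degree (negPf v0).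
  case: ltnP => // nv; case/negP: vl; apply/codomP.
  have hv : v - n < n by have := ltn_ord v; clear -nv n0; lia.
  by exists (Ordinal hv); apply: val_inj; rewrite /= subnKC.
- by move=> i j /(congr1 val) /= /addnI /val_inj.
- move=> i; rewrite /is_leaf heap_degree /= [_ + _ < n]ltnNge leq_addr /=.
  by rewrite addn_eq0 -[n == 0]negbK -lt0n n0.
- move=> v; rewrite /is_leaf heap_degree => nl.
  have hv : maxn 1 (2 * v) < 2 * n.
    have [v0|v0] := eqVneq (nat_of_ord v) 0; first by rewrite v0; clear -n0; lia.
    by move: nl; rewrite (negPf v0); case: ltnP => // vn _; clear -vn; lia.
  exists (Ordinal hv); last by apply: tl; rewrite /=; clear; lia.
  by rewrite /heap_arc /=; move: (val v); clear; lia.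
- by move=> v u; rewrite (negPf (nr v)).
Qed.

End Heap.

(** Existence of a network is what gives the random network law total mass 1. *)
Lemma reps_gt0 n : 0 < n -> 0 < #|network_reps n|.
Proof.
move=> n0; have [N [rN _]] := reps_complete (heap_simplex n0).
by apply/card_gt0P; exists N.
Qed.

Definition atypical r n (N : network n) : pred (vertex N) :=
  let k := r.+2 in [pred u | is_tree (arc N) u && `[< exists v,
    [/\ v \in fball (arc N) (2 * k * (2 * k + 5)) u, is_tree (arc N) v &
        ~~ nice (arc N) v \/ bad (arc N) (4 * k) v] >]].

Arguments atypical r {n} N.

Lemma typical_iso r n (N : network n) u : is_tree (arc N) u -> ~~ atypical r N u ->
  rgraph_iso (neighbourhood r (rooted_at u)) (neighbourhood r decorated_chain).
Proof.
move=> tu; rewrite /atypical /= tu /= => h.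
apply: (@neighbourhood_iso n N r.+2 u tu) => // v vu tv.
split.
  by apply: contraNT h => nv; apply: asboolT; exists v; split => //; left.
by move=> bv; case/negP: h; apply: asboolT; exists v; split => //; right.
Qed.

(** For such [n] at least half of the regrafting sites remain, so the factor [n] cancels. *)
Lemma sum_bad_const L n : 2 * (L + 3) <= n ->
  \sum_(N in network_reps n) #|[pred w | `[< bad (arc N) L w >]]| <=
  #|network_reps n| * (8 * 4 ^ L.+2).
Proof.
move=> hn; have := sum_bad n L; rewrite -big_distrl /=.
move: (bigop _ _ _) #|_| (4 ^ _) => S K c.
case: (posnP n) => [n0|n0]; first by rewrite n0 addn3 in hn.
move=> h; rewrite -(leq_pmul2r n0).
apply: (@leq_trans (2 * (S * (n - (L + 3))))); last by clear -h; nia.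
rewrite mulnCA leq_mul2l; apply/orP; right; clear -hn; lia.
Qed.

Lemma sum_tree_leaf J n : 2 * (J + 4) <= n ->
  J * (\sum_(N in network_reps n) #|tree_leaf (arc N)|) <=
  #|network_reps n| * (J * (8 * 4 ^ J.+3) + J + 4 * n).
Proof.
move=> hn.
have h : J * (\sum_(N in network_reps n) #|[pred l | `[< near (arc N) J l >]]|) <=
    #|network_reps n| * (J * (8 * 4 ^ J.+3)).
  rewrite mulnCA leq_mul2l; apply/orP; right.
  apply: leq_trans (sum_near n J) _; apply: sum_bad_const; clear -hn; lia.
rewrite big_distrr /=.
apply: (@leq_trans (\sum_(N in network_reps n)
  (J * #|[pred l | `[< near (arc N) J l >]]| + (J + 4 * n)))).
  by apply: leq_sum => N _; rewrite addnA; exact: (leq_tree_leaf (network_simplex N)).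
rewrite big_split /= -big_distrr sum_nat_const /=.
by rewrite -addnA [leqRHS]mulnDr leq_add2r.
Qed.

(** Since [n.-1] bounds the number of tree vertices from below, this makes the mean proportion of
    atypical vertices at most [1 / M]. *)
Lemma atypical_sparse r M : exists n1, forall n, n1 <= n ->
  M * (\sum_(N in network_reps n) #|atypical r N|) <= #|network_reps n| * n.-1.
Proof.
pose k := r.+2; pose R := 2 * k * (2 * k + 5); pose L := 4 * k.
(* The term linear in [n] is [b * n], from the at most [4 n / J] far tree leaves, doubled by
   [card_nnice]. As [b * n <= 2 * b * n.-1] and the constant [a] is at most [n.-1], dividing by this
   [J] leaves [n.-1 / M]. *)
pose b := 4 ^ R * 8; pose J := M * (2 * b + 1).
pose cL := 8 * 4 ^ L.+2; pose cJ := 8 * 4 ^ J.+3.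
pose a := 4 ^ R * (2 * (J * cJ + J) + J * cL).
exists (2 * (L + 3) + 2 * (J + 4) + (a + 2)) => n hn.
have hL : 2 * (L + 3) <= n by clear -hn; lia.
have hJ : 2 * (J + 4) <= n by clear -hn; lia.
have ha : a + 2 <= n by clear -hn; lia.
have h1 := sum_bad_const hL; have h2 := sum_tree_leaf hJ.
set B := \sum_(N in _) #|atypical _ _|; set K := #|_| in h1 h2 *.
set S1 := \sum_(N in _) _ in h1; set S2 := \sum_(N in _) _ in h2.
have hB : B <= 4 ^ R * (2 * S2 + S1).
  rewrite /S1 /S2 !big_distrr -big_split big_distrr /=; apply: leq_sum => N _.
  exact: (card_near_bad (network_simplex N)).
have hJB : J * B <= K * (a + b * n).
  have e : 4 ^ R * (2 * (K * (J * cJ + J + 4 * n)) + J * (K * cL)) = K * (a + b * n).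
    by rewrite /a /b; generalize (4 ^ R) K cL cJ J n; clear; move=> *; nia.
  rewrite -e; apply: (@leq_trans (4 ^ R * (2 * (J * S2) + J * S1))).
    by rewrite [leqRHS](_ : _ = J * (4 ^ R * (2 * S2 + S1))) ?leq_mul2l ?hB ?orbT //; clear; nia.
  by rewrite leq_mul2l leq_add ?orbT // leq_mul2l ?h1 ?h2 orbT.
have [->|M0] := posnP M; first by rewrite mul0n.
have b0 : 0 < 2 * b + 1 by rewrite addn1.
rewrite -(leq_pmul2l b0) mulnA [_ * M]mulnC -/J.
apply: leq_trans hJB _; rewrite mulnCA leq_mul2l; apply/orP; right.
have n1 : 0 < n.-1 by clear -ha; lia.
have bn : b * n <= 2 * (b * n.-1).
  by rewrite -mulnCA leq_mul2l; apply/orP; right; clear -n1; lia.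
rewrite mulnDl mul1n -mulnA addnC leq_add //; clear -ha; lia.
Qed.

Section Limit.
Variables (R : realType) (q : forall (n : nat) (N : network n), vertex N -> R).
Hypothesis hq : forall (n : nat) (N : network n), uniform_tree_vertex (q (n := n) (N := N)).
Local Open Scope classical_set_scope.
Local Open Scope ring_scope.

Lemma law_le_atypical r (A : rgraph -> Prop) n :
  (forall (N : network n) u, is_tree (arc N) u -> A (rooted_at u) -> atypical r N u) ->
  (1 < n)%N ->
  random_network_law (q (n := n)) A <=
    (\sum_(N in network_reps n) #|atypical r N|)%:R / (#|network_reps n| * n.-1)%:R.
Proof.
move=> hA n1; rewrite /random_network_law natr_sum mulr_suml; apply: ler_sum => N _.
rewrite natrM invfM mulrCA; apply: ler_wpM2l; first by rewrite invr_ge0.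
rewrite -sum1_card natr_sum mulr_suml [leRHS]big_mkcond /=; apply: ler_sum => v _.
have HN := network_simplex N; have [q0 _ qT] := hq N.
have hT : (n.-1 <= #|is_tree (arc N)|)%N by have := leq_tree_count HN; clear; lia.
have n0 : (0 < n.-1)%N by clear -n1; lia.
have [t ht] : exists t, is_tree (arc N) t.
  by have /card_gt0P[t] := leq_trans n0 hT; exists t.
rewrite (qT (ex_intro _ t ht)).
have [tv|_] := boolP (is_tree (arc N) v); last by rewrite mul0r; case: ifP.
case: asboolP => Av; last by rewrite mulr0; case: ifP.
have -> : v \in atypical r N by exact: hA.
rewrite mulr1 mul1r lef_pV2 ?posrE ?ltr0n //.
  by rewrite ler_nat.
exact: leq_trans n0 hT.
Qed.

Lemma law_atypical_cvg0 r (A : rgraph -> Prop) :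
  (forall n (N : network n) u, is_tree (arc N) u -> A (rooted_at u) -> atypical r N u) ->
  forall e : R, 0 < e -> \forall n \near \oo, random_network_law (q (n := n)) A <= e.
Proof.
move=> hA e e0; have [n1 hn1] := atypical_sparse r (Num.truncn e^-1).+1.
near=> n.
have n2 : (1 < n)%N by near: n; exists 2%N.
have hn : (n1 <= n)%N by near: n; exists n1.
apply: le_trans (law_le_atypical (hA n) n2) _.
have K0 : (0 < #|network_reps n| * n.-1)%N.
  by rewrite muln_gt0 reps_gt0 ?(ltnW n2) //=; clear -n2; lia.
rewrite ler_pdivrMr ?ltr0n // -ler_pdivrMl //.
apply: le_trans (_ : (Num.truncn e^-1).+1%:R * _ <= _).
  by apply: ler_wpM2r => //; apply: ltW; rewrite truncnS_gt.
by rewrite -natrM ler_nat hn1.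
Unshelve. all: by end_near.
Qed.

Lemma law_ge0 n A : 0 <= random_network_law (q (n := n)) A.
Proof.
apply: sumr_ge0 => N _; apply: mulr_ge0; first by rewrite invr_ge0.
by apply: sumr_ge0 => v _; have [q0 _ _] := hq N; apply: mulr_ge0.
Qed.

Lemma law_compl n A : (0 < n)%N -> random_network_law (q (n := n)) A =
  1 - random_network_law (q (n := n)) (fun G => ~ A G).
Proof.
move=> n0; apply/eqP; rewrite eq_sym subr_eq eq_sym; apply/eqP.
rewrite /random_network_law -big_split /=.
under eq_bigr => N _.
  have [_ q1 _] := hq N.
  rewrite -mulrDr -big_split /=.
  under eq_bigr => v _ do rewrite -mulrDr asbool_neg -natrD addnC addn_negb mulr1.
  rewrite q1 mulr1; over.
rewrite sumr_const -[LHS]mulr_natr mulVf // pnatr_eq0 -lt0n; exact: reps_gt0.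
Qed.

End Limit.

Theorem theorem1p7 (R : realType)
    (q : forall (n : nat) (N : network n), vertex N -> R)
    (hq : forall (n : nat) (N : network n), uniform_tree_vertex (q n N)) :
  local_weak_cvg (fun n : nat => random_network_law (q n))
    (deterministic R decorated_chain).
Proof.
move=> r G _.
pose A := fun N => rgraph_iso (neighbourhood r N) G.
have typ n (N : network n) u : is_tree (arc N) u ->
    ~ rgraph_iso (neighbourhood r (rooted_at u)) (neighbourhood r decorated_chain) ->
    atypical r N u.
  by move=> tu h; apply: contraT => /(typical_iso tu).
(* The limit is 1 or 0. In either case the event on which [G] is misjudged forces [u_n] to be
   atypical; for the limit 1 this is applied to the complement. *)
rewrite /deterministic; case: asboolP => hG.
  apply/cvgrPdist_le => e e0.
  have hA n (N : network n) u : is_tree (arc N) u -> ~ A (rooted_at u) -> atypical r N u.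
    by move=> tu h; apply: typ => // h'; apply: h; exact: rgraph_iso_trans h' hG.
  near=> n.
  have n0 : (0 < n)%N by near: n; exists 1%N.
  rewrite -/(A) (law_compl hq A n0) opprB addrCA subrr addr0 ger0_norm ?law_ge0 //.
  by near: n; exact: (law_atypical_cvg0 hq hA).
apply/cvgrPdist_le => e e0.
have hA n (N : network n) u : is_tree (arc N) u -> A (rooted_at u) -> atypical r N u.
  move=> tu h; apply: typ => // h'; apply: hG.
  exact: rgraph_iso_trans (rgraph_iso_sym h') h.
near=> n; rewrite sub0r normrN ger0_norm ?law_ge0 //.
by near: n; exact: (law_atypical_cvg0 hq hA).
Unshelve. all: by end_near.
Qed.
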